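(* Min-Cost SP-MVE can be solved in $O(m\cdot\ell^2)$ time on two-terminal series-parallel graphs in which $s$ and $t$ are the two terminals, where $m$ is the number of edges.
   Context: Min-Cost SP-MVE is the optimization problem: given an undirected graph $G=(V,E)$ with positive integer edge lengths $\tau\colon E\to\mathbb{N}$, vertices $s,t\in V$, and an integer $\ell$, find a minimum-cardinality edge set $S\subseteq E$ such that every $st$-path in $G-S$ has length (sum of edge lengths) at least $\ell$. A two-terminal graph is a graph together with two distinct designated vertices (terminals). Two-terminal series-parallel graphs are those obtainable, starting from single edges (whose endpoints are the terminals), by repeated serial compositions (disjoint union of $(G_1,s_1,t_1)$ and $(G_2,s_2,t_2)$ with $t_1$ identified with $s_2$, terminals $s_1,t_2$) and parallel compositions (disjoint union with $s_1$ identified with $s_2$ and $t_1$ identified with $t_2$, these identified vertices being the terminals). *)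

(* Defs.v *)
From HB Require Import structures.
From mathcomp Require Import all_boot all_order all_algebra.

Set Implicit Arguments.
Unset Strict Implicit.
Unset Printing Implicit Defensive.

Import Order.TTheory GRing.Theory Num.Theory.

(** * Two-terminal graphs *)

(* Vertices and edges are numbered, so that a graph can be written into the
   memory of a machine.  Parallel edges are allowed, since parallel composition
   creates them.  The order of the pair [ends e] carries no meaning: the graph
   is undirected, and [ends] is only used through [joins] and [encode]. *)
Record ttgraph := TTGraph {
  nv : nat;
  ne : nat;
  ends : 'I_ne -> 'I_nv * 'I_nv;
  source : 'I_nv;
  sink : 'I_nv;
  source_neq_sink : source != sink }.

Definition joins (G : ttgraph) (e : 'I_(ne G)) (u v : 'I_(nv G)) : bool :=
  (ends e == (u, v)) || (ends e == (v, u)).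

(* [f] is a quotient map of [A] by the identification of the two components of
   every pair in [ps].  The right-hand side is an equivalence relation when no
   element of [A] occurs twice in [ps], as in both uses below. *)
Definition identifies (A B : eqType) (f : A -> B) (ps : seq (A * A)) : Prop :=
  (forall b, exists a, f a = b) /\
  (forall x y, f x = f y <-> [\/ x = y, (x, y) \in ps | (y, x) \in ps]).

(* [G] is, up to renumbering of vertices and edges, the disjoint union of [G1]
   and [G2] with the vertices paired in [ps] identified; [f] and [g] send the
   vertices and edges of the disjoint union to those of [G]. *)
Definition is_gluing (G1 G2 G : ttgraph)
    (f : 'I_(nv G1) + 'I_(nv G2) -> 'I_(nv G))
    (g : 'I_(ne G1) + 'I_(ne G2) -> 'I_(ne G))
    (ps : seq (('I_(nv G1) + 'I_(nv G2)) * ('I_(nv G1) + 'I_(nv G2)))) : Prop :=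
  [/\ identifies f ps,
      bijective g,
      forall e, joins (g (inl e)) (f (inl (ends e).1)) (f (inl (ends e).2)) &
      forall e, joins (g (inr e)) (f (inr (ends e).1)) (f (inr (ends e).2))].

Definition single_edge (G : ttgraph) : Prop :=
  [/\ nv G = 2, ne G = 1 & forall e, joins e (source G) (sink G)].

Definition serial_composition (G1 G2 G : ttgraph) : Prop :=
  exists f g,
    [/\ @is_gluing G1 G2 G f g [:: (inl (sink G1), inr (source G2))],
        source G = f (inl (source G1)) &
        sink G = f (inr (sink G2))].

Definition parallel_composition (G1 G2 G : ttgraph) : Prop :=
  exists f g,
    [/\ @is_gluing G1 G2 G f g [:: (inl (source G1), inr (source G2));
                                   (inl (sink G1), inr (sink G2))],
        source G = f (inl (source G1)) &
        sink G = f (inl (sink G1))].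

Inductive series_parallel : ttgraph -> Prop :=
| SP_edge G : single_edge G -> series_parallel G
| SP_serial G1 G2 G :
    series_parallel G1 -> series_parallel G2 ->
    serial_composition G1 G2 G -> series_parallel G
| SP_parallel G1 G2 G :
    series_parallel G1 -> series_parallel G2 ->
    parallel_composition G1 G2 G -> series_parallel G.

(** * Min-Cost SP-MVE *)

(* A step [(e, v)] of a walk traverses the edge [e] and arrives at [v]. *)
Fixpoint is_walk (G : ttgraph) (S : {set 'I_(ne G)}) (x : 'I_(nv G))
    (p : seq ('I_(ne G) * 'I_(nv G))) (y : 'I_(nv G)) : bool :=
  if p is (e, v) :: p' then [&& e \notin S, joins e x v & is_walk S v p' y]
  else x == y.

Definition is_st_path (G : ttgraph) (S : {set 'I_(ne G)})
    (p : seq ('I_(ne G) * 'I_(nv G))) : bool :=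
  is_walk S (source G) p (sink G) && uniq (source G :: [seq ev.2 | ev <- p]).

Definition path_length (G : ttgraph) (tau : 'I_(ne G) -> nat)
    (p : seq ('I_(ne G) * 'I_(nv G))) : nat :=
  \sum_(ev <- p) tau ev.1.

Definition feasible (G : ttgraph) (tau : 'I_(ne G) -> nat) (l : int)
    (S : {set 'I_(ne G)}) : Prop :=
  forall p, is_st_path S p -> (l <= Posz (path_length tau p))%R.

Definition min_cost_solution (G : ttgraph) (tau : 'I_(ne G) -> nat) (l : int)
    (S : {set 'I_(ne G)}) : Prop :=
  feasible tau l S /\ forall S', feasible tau l S' -> #|S| <= #|S'|.

(** * Random access machines with uniform cost *)

(* A structured random access machine: registers and memory cells hold
   integers, memory is addressed by natural numbers through computed addresses,
   and every operation costs one time unit per syntax node executed.  There is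
   no multiplication, which at uniform cost would be unreasonably strong. *)
Inductive expr :=
| Cst of int
| Reg of nat
| Add of expr & expr
| Sub of expr & expr.

Inductive test :=
| Le of expr & expr
| Eq of expr & expr
| Not of test
| And of test & test.

Inductive cmd :=
| Skip
| Assign of nat & expr
| Read of nat & expr
| Write of expr & expr
| Seq of cmd & cmd
| If of test & cmd & cmd
| While of test & cmd.

Definition regs := nat -> int.
Definition memory := nat -> int.

Fixpoint eval (r : regs) (e : expr) : int :=
  match e with
  | Cst c => c
  | Reg x => r x
  | Add e1 e2 => (eval r e1 + eval r e2)%R
  | Sub e1 e2 => (eval r e1 - eval r e2)%R
  end.

Fixpoint expr_cost (e : expr) : nat :=
  match e with
  | Cst _ | Reg _ => 1
  | Add e1 e2 | Sub e1 e2 => (expr_cost e1 + expr_cost e2).+1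
  end.

Fixpoint eval_test (r : regs) (b : test) : bool :=
  match b with
  | Le e1 e2 => (eval r e1 <= eval r e2)%R
  | Eq e1 e2 => eval r e1 == eval r e2
  | Not b1 => ~~ eval_test r b1
  | And b1 b2 => eval_test r b1 && eval_test r b2
  end.

Fixpoint test_cost (b : test) : nat :=
  match b with
  | Le e1 e2 | Eq e1 e2 => (expr_cost e1 + expr_cost e2).+1
  | Not b1 => (test_cost b1).+1
  | And b1 b2 => (test_cost b1 + test_cost b2).+1
  end.

Definition update (f : nat -> int) (x : nat) (c : int) : nat -> int :=
  fun y => if y == x then c else f y.

(* [run P r M k r' M']: started with registers [r] and memory [M], the program
   [P] halts after time [k] with registers [r'] and memory [M'].  An access to a
   negative address has no rule: the machine crashes instead of halting. *)
Inductive run : cmd -> regs -> memory -> nat -> regs -> memory -> Prop :=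
| RunSkip r M : run Skip r M 1 r M
| RunAssign x e r M :
    run (Assign x e) r M (expr_cost e).+1 (update r x (eval r e)) M
| RunRead x e r M (a : nat) :
    eval r e = Posz a ->
    run (Read x e) r M (expr_cost e).+1 (update r x (M a)) M
| RunWrite e1 e2 r M (a : nat) :
    eval r e1 = Posz a ->
    run (Write e1 e2) r M (expr_cost e1 + expr_cost e2).+1
        r (update M a (eval r e2))
| RunSeq P Q r M k1 r1 M1 k2 r2 M2 :
    run P r M k1 r1 M1 -> run Q r1 M1 k2 r2 M2 ->
    run (Seq P Q) r M (k1 + k2) r2 M2
| RunIfTrue b P Q r M k r' M' :
    eval_test r b -> run P r M k r' M' ->
    run (If b P Q) r M (test_cost b + k).+1 r' M'
| RunIfFalse b P Q r M k r' M' :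
    ~~ eval_test r b -> run Q r M k r' M' ->
    run (If b P Q) r M (test_cost b + k).+1 r' M'
| RunWhileTrue b P r M k1 r1 M1 k2 r2 M2 :
    eval_test r b -> run P r M k1 r1 M1 -> run (While b P) r1 M1 k2 r2 M2 ->
    run (While b P) r M (test_cost b + k1 + k2).+1 r2 M2
| RunWhileFalse b P r M :
    ~~ eval_test r b -> run (While b P) r M (test_cost b).+1 r M.

(** * Input and output *)

(* The input is the plain edge list; no decomposition of [G] is supplied. *)
Definition encode (G : ttgraph) (tau : 'I_(ne G) -> nat) (l : int) : seq int :=
  [:: Posz (nv G); Posz (ne G); Posz (source G); Posz (sink G); l] ++
  flatten [seq [:: Posz (ends e).1; Posz (ends e).2; Posz (tau e)]
          | e <- enum 'I_(ne G)].

Definition init_regs : regs := fun=> 0%R.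
Definition init_memory (w : seq int) : memory := fun a => nth 0%R w a.

(* Cell 0 holds the cardinality of [S], and the following cells list the
   elements of [S] without repetition, in any order. *)
Definition outputs (m : nat) (M : memory) (S : {set 'I_m}) : Prop :=
  exists2 es : seq 'I_m, perm_eq es (enum S) &
    M 0 = Posz (size es) /\
    [seq M i.+1 | i <- iota 0 (size es)] = [seq Posz e | e : 'I_m <- es].

(* Main.v *)
Require Import Defs.
From HB Require Import structures.
From mathcomp Require Import all_boot all_order all_algebra.
From mathcomp Require Import zify.
From Stdlib Require PeanoNat.

Set Implicit Arguments.
Unset Strict Implicit.
Unset Printing Implicit Defensive.

(** Parallel edges are merged, and an inner vertex of degree two is eliminated by
    joining its two neighbours, so that each edge of the current simple graph
    stands for a composition tree over edges of the input.  In a series-parallel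
    graph some sequence of eliminations reaches the single edge [st], and
    eliminations commute, so every maximal sequence does.  Each step takes time
    independent of the graph: besides an adjacency matrix in sparse memory one
    keeps for every vertex its degree, the sum of its neighbours and one
    neighbour.  The last suffices, because after the elimination of [v] its
    neighbours [u] and [w] are adjacent to each other; and the two neighbours of
    a vertex of degree two are then the known one and the sum minus it.

    Every tree carries the table [j |-> copt T j] of the least number of deletions
    that push its terminals to distance [j]: a sum for parallel composition and a
    min-plus convolution, computed in time [l ^ 2], for serial composition.  An
    optimal set is read off the tables top down.  That the distance of the final
    tree is the distance in [G] is shown from above by walks and from below by
    extending potentials across each eliminated vertex. *)

(** * Programs over sixteen arrays of natural numbers *)

(** Vertices of degree two have to be found without searching. Candidates are kept on a stack: among
    the vertices that remain, an elimination can lower only the degrees of [u] and [w], these two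
    are pushed again, and an amortised count keeps the number of pops linear. The adjacency matrix
    has quadratically many cells but is never initialised, since every cell past the input starts at
    0. Its row offsets are tabulated by repeated addition, because the machine cannot multiply. A
    time of order [l ^ 2] is spent only on eliminations, of which there is at most one per vertex;
    merging two parallel edges, creating a leaf and tracing a node each take time linear in [l]. The
    program computes with natural numbers throughout: a nonpositive [l] is split off at the start,
    and every subtraction comes with a proof that it is not truncated. *)

Fixpoint neval (r : nat -> nat) (e : expr) : nat :=
  match e with
  | Cst c => absz c
  | Reg x => r x
  | Add e1 e2 => neval r e1 + neval r e2
  | Defs.Sub e1 e2 => neval r e1 - neval r e2
  end.

(* [neval] agrees with [eval] only if no constant is negative and no
   subtraction is truncated. *)
Fixpoint nsafe (r : nat -> nat) (e : expr) : bool :=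
  match e with
  | Cst (Posz _) | Reg _ => true
  | Cst (Negz _) => false
  | Add e1 e2 => nsafe r e1 && nsafe r e2
  | Defs.Sub e1 e2 => [&& nsafe r e1, nsafe r e2 & neval r e2 <= neval r e1]
  end.

Fixpoint ntest (r : nat -> nat) (b : test) : bool :=
  match b with
  | Le e1 e2 => neval r e1 <= neval r e2
  | Eq e1 e2 => neval r e1 == neval r e2
  | Not b1 => ~~ ntest r b1
  | And b1 b2 => ntest r b1 && ntest r b2
  end.

Fixpoint nsafe_test (r : nat -> nat) (b : test) : bool :=
  match b with
  | Le e1 e2 | Eq e1 e2 => nsafe r e1 && nsafe r e2
  | Not b1 => nsafe_test r b1
  | And b1 b2 => nsafe_test r b1 && nsafe_test r b2
  end.

(** In [AGet x k e] and [APut k e1 e2] the number [k] selects an array, and the expression that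
    follows it is the index. *)
Inductive acmd :=
| ASkip
| ASet of nat & expr
| AGet of nat & nat & expr
| APut of nat & expr & expr
| ASeq of acmd & acmd
| AIf of test & acmd & acmd
| AWhile of test & acmd.

(** Four doublings replace a multiplication; the cost grows by a constant factor only. *)
Definition times16 (e : expr) : expr :=
  let e2 := Add e e in let e4 := Add e2 e2 in let e8 := Add e4 e4 in Add e8 e8.

(* Array [k < 16] is spread over the cells [B + 16 * i + k], where register 0
   holds [B]; array 16 is the block of cells below [B]. *)
Definition address (k : nat) (e : expr) : expr :=
  if Nat.eqb k 16 then e else Add (Add (Reg 0) (times16 e)) (Cst (Posz k)).

Fixpoint compile (c : acmd) : cmd :=
  match c with
  | ASkip => Skip
  | ASet x e => Assign x e
  | AGet x k e => Read x (address k e)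
  | APut k e1 e2 => Write (address k e1) e2
  | ASeq c1 c2 => Seq (compile c1) (compile c2)
  | AIf b c1 c2 => If b (compile c1) (compile c2)
  | AWhile b c1 => While b (compile c1)
  end.

(* A loop gets the junk value 0, and [vc] below rejects it. *)
Fixpoint acost (c : acmd) : nat :=
  match c with
  | ASkip => 1
  | ASet x e => (expr_cost e).+1
  | AGet x k e => (expr_cost (address k e)).+1
  | APut k e1 e2 => (expr_cost (address k e1) + expr_cost e2).+1
  | ASeq c1 c2 => acost c1 + acost c2
  | AIf b c1 c2 => (test_cost b + (acost c1 + acost c2)).+1
  | AWhile b c1 => 0
  end.

(** With [Nat.eqb] the updates compute on literal register and array numbers, so symbolic execution
    is plain simplification. *)
Definition upd (r : nat -> nat) (x v : nat) : nat -> nat :=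
  fun y => if Nat.eqb y x then v else r y.

Definition aupd (a : nat -> nat -> nat) (k i v : nat) : nat -> nat -> nat :=
  fun k' => if Nat.eqb k' k then upd (a k') i v else a k'.

Arguments upd r !x v !y /.
Arguments aupd a !k i v !k' /.

Lemma updE r x v y : upd r x v y = if y == x then v else r y.
Proof. by rewrite /upd; case: (PeanoNat.Nat.eqb_spec y x) => [->|/eqP/negbTE->]; rewrite ?eqxx. Qed.

Lemma upd_same r x v : upd r x v x = v. Proof. by rewrite updE eqxx. Qed.
Lemma upd_diff r x v y : y != x -> upd r x v y = r y.
Proof. by rewrite updE => /negbTE->. Qed.

Lemma aupd_diff a k i v k' : k' != k -> aupd a k i v k' = a k'.
Proof. by rewrite /aupd; case: PeanoNat.Nat.eqb_spec => // ->; rewrite eqxx. Qed.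

Section Machine.
Variable B : nat.

(** The weakest precondition of a loop-free command. Register 0 must not be assigned, as it holds
    [B], and an index into array 16 has to stay below [B]; the other arrays are unbounded. *)
Fixpoint vc (c : acmd) (r : nat -> nat) (a : nat -> nat -> nat)
    (Q : (nat -> nat) -> (nat -> nat -> nat) -> Prop) : Prop :=
  match c with
  | ASkip => Q r a
  | ASet x e => [/\ ~~ Nat.eqb x 0, nsafe r e & Q (upd r x (neval r e)) a]
  | AGet x k e =>
      [/\ ~~ Nat.eqb x 0, nsafe r e,
          (Nat.leb k 15 || (neval r e < B)) && Nat.leb k 16 &
          Q (upd r x (a k (neval r e))) a]
  | APut k e1 e2 =>
      [/\ nsafe r e1, nsafe r e2,
          (Nat.leb k 15 || (neval r e1 < B)) && Nat.leb k 16 &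
          Q r (aupd a k (neval r e1) (neval r e2))]
  | ASeq c1 c2 => vc c1 r a (fun r1 a1 => vc c2 r1 a1 Q)
  | AIf b c1 c2 =>
      nsafe_test r b /\
      (if ntest r b then vc c1 r a Q else vc c2 r a Q)
  | AWhile _ _ => False
  end.

Definition rep (r : nat -> nat) (a : nat -> nat -> nat) (R : regs) (M : memory) :=
  [/\ forall x, R x = Posz (r x), r 0 = B,
      forall k i, k < 16 -> M (B + 16 * i + k) = Posz (a k i) &
      forall i, i < B -> M i = Posz (a 16 i)].

(** Total correctness with the time bound [t] built in, so that halting, running time and result
    come from one derivation. *)
Definition awp (c : acmd) (t : nat) (r : nat -> nat) (a : nat -> nat -> nat)
    (Q : (nat -> nat) -> (nat -> nat -> nat) -> Prop) : Prop :=
  forall R M, rep r a R M ->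
  exists k R' M' r' a',
    [/\ run (compile c) R M k R' M', k <= t, rep r' a' R' M' & Q r' a'].

Lemma eval_neval r R e :
  (forall x, R x = Posz (r x)) -> nsafe r e -> eval R e = Posz (neval r e).
Proof.
move=> hR; elim: e => [[]//|x|e1 IH1 e2 IH2|e1 IH1 e2 IH2] /=; first by rewrite hR.
  by case/andP=> /IH1-> /IH2->.
by case/and3P=> /IH1-> /IH2-> le21; lia.
Qed.

Lemma eval_ntest r R b :
  (forall x, R x = Posz (r x)) -> nsafe_test r b -> eval_test R b = ntest r b.
Proof.
move=> hR; elim: b => [e1 e2|e1 e2|b IH|b1 IH1 b2 IH2] /=.
- by case/andP=> /(eval_neval hR)-> /(eval_neval hR)->.
- by case/andP=> /(eval_neval hR)-> /(eval_neval hR)->.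
- by move/IH->.
- by case/andP=> /IH1-> /IH2->.
Qed.

Lemma address_inj k k' i i' :
  k < 16 -> k' < 16 -> (B + 16 * i + k == B + 16 * i' + k') = (k == k') && (i == i').
Proof. by move=> *; apply/idP/idP; lia. Qed.

Lemma rep_set r a R M x v :
  ~~ Nat.eqb x 0 -> rep r a R M -> rep (upd r x v) a (update R x (Posz v)) M.
Proof.
move=> x0 [hR h0 hA hM]; split=> //.
  by move=> y; rewrite /update updE; case: ifP.
by rewrite updE; case: eqP x0 => [<-|].
Qed.

Lemma rep_put r a R M k i v :
  (Nat.leb k 15 || (i < B)) && Nat.leb k 16 -> rep r a R M ->
  rep r (aupd a k i v) R
      (update M (if Nat.eqb k 16 then i else B + 16 * i + k) (Posz v)).
Proof.
move=> hk [hR h0 hA hM].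
case: (PeanoNat.Nat.eqb_spec k 16) hk => [->/=|k16 hk].
  rewrite andbT => iB; split=> // [k' i' k'16|i' i'B]; rewrite /update /aupd.
    have /negbTE-> : B + 16 * i' + k' != i by lia.
    have -> : Nat.eqb k' 16 = false by lia.
    exact: hA.
  by rewrite /= updE; case: ifP => // _; exact: hM.
have {}hk : k < 16 by lia.
split=> // [k' i' k'16|i' i'B]; rewrite /update /aupd.
  rewrite address_inj //; case: (PeanoNat.Nat.eqb_spec k' k) => [->|/eqP/negbTE->] /=; last exact: hA.
  by rewrite eqxx /= updE; case: ifP => // _; exact: hA.
have /negbTE-> : i' != B + 16 * i + k by lia.
have -> : Nat.eqb 16 k = false by lia.
exact: hM.
Qed.

Lemma rep_address r a R M k e :
  (Nat.leb k 15 || (neval r e < B)) && Nat.leb k 16 -> rep r a R M -> nsafe r e ->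
  let i := neval r e in let ad := if Nat.eqb k 16 then i else B + 16 * i + k in
  eval R (address k e) = Posz ad /\ M ad = Posz (a k i).
Proof.
move=> hk [hR h0 hA hM] se; rewrite /address.
case: (PeanoNat.Nat.eqb_spec k 16) hk => [->/=|k16 hk].
  by rewrite andbT => hk; rewrite (eval_neval hR) // hM.
rewrite /= !(eval_neval hR) // hR h0 hA; last lia.
by split=> //; lia.
Qed.

Lemma awp_straight c r a Q : vc c r a Q -> awp c (acost c) r a Q.
Proof.
elim: c r a Q => [|x e|x k e|k e1 e2|c1 IH1 c2 IH2|b c1 IH1 c2 IH2|b c1 IH1] //= r a Q.
- by move=> hQ R M h; exists 1, R, M, r, a; split=> //; constructor.
- case=> x0 se hQ R M h; exists (expr_cost e).+1, (update R x (Posz (neval r e))), M.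
  exists (upd r x (neval r e)), a; split=> //; last exact: rep_set.
  by rewrite -(@eval_neval r R) //; [constructor | case: h].
- case=> x0 se hk hQ R M h; have [h1 h2] := rep_address hk h se.
  eexists _, _, _, _, _; split; [exact: RunRead h1 | by [] | | exact: hQ].
  by rewrite h2; exact: rep_set.
- case=> se1 se2 hk hQ R M h; have [h1 _] := rep_address hk h se1.
  eexists _, _, _, _, _; split; [exact: RunWrite h1 | by [] | | exact: hQ].
  by rewrite (@eval_neval r R) //; [exact: rep_put | case: h].
- move=> h R M hrep; have [k1 [R1 [M1 [r1 [a1 [h1 le1 rep1 {}h]]]]]] := IH1 _ _ _ h _ _ hrep.
  have [k2 [R2 [M2 [r2 [a2 [h2 le2 rep2 {}h]]]]]] := IH2 _ _ _ h _ _ rep1.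
  exists (k1 + k2), R2, M2, r2, a2; split=> //; [exact: RunSeq h1 h2 | exact: leq_add].
- case=> sb h R M hrep; have hb : eval_test R b = ntest r b.
    by apply: eval_ntest sb; case: hrep.
  case: ifP h => tb h.
    have [k1 [R1 [M1 [r1 [a1 [h1 le1 rep1 {}h]]]]]] := IH1 _ _ _ h _ _ hrep.
    exists (test_cost b + k1).+1, R1, M1, r1, a1; split=> //; last lia.
    by apply: RunIfTrue; rewrite ?hb.
  have [k1 [R1 [M1 [r1 [a1 [h1 le1 rep1 {}h]]]]]] := IH2 _ _ _ h _ _ hrep.
  exists (test_cost b + k1).+1, R1, M1, r1, a1; split=> //; last lia.
  by apply: RunIfFalse; rewrite ?hb ?tb.
Qed.

Lemma awp_weaken c t t' r a (Q Q' : _ -> _ -> Prop) :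
  awp c t r a Q -> t <= t' -> (forall r' a', Q r' a' -> Q' r' a') -> awp c t' r a Q'.
Proof.
move=> h lt hQ R M /h[k [R' [M' [r' [a' [h1 h2 h3 h4]]]]]].
exists k, R', M', r', a'; split=> //; [exact: leq_trans lt | exact: hQ].
Qed.

Lemma awp_seq c1 c2 t1 t2 r a Q :
  awp c1 t1 r a (fun r1 a1 => awp c2 t2 r1 a1 Q) -> awp (ASeq c1 c2) (t1 + t2) r a Q.
Proof.
move=> h R M /h[k1 [R1 [M1 [r1 [a1 [h1 le1 rep1 {}h]]]]]].
have [k2 [R2 [M2 [r2 [a2 [h2 le2 rep2 {}h]]]]]] := h _ _ rep1.
by exists (k1 + k2), R2, M2, r2, a2; split=> //; [exact: RunSeq h1 h2 | exact: leq_add].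
Qed.

Lemma awp_straight_seq c1 c2 t r a Q :
  vc c1 r a (fun r1 a1 => awp c2 t r1 a1 Q) -> awp (ASeq c1 c2) (acost c1 + t) r a Q.
Proof. by move=> /awp_straight; exact: awp_seq. Qed.

Lemma awp_if b c1 c2 t r a Q :
  nsafe_test r b -> (ntest r b -> awp c1 t r a Q) -> (~~ ntest r b -> awp c2 t r a Q) ->
  awp (AIf b c1 c2) (test_cost b + t).+1 r a Q.
Proof.
move=> sb h1 h2 R M hrep; have hb : eval_test R b = ntest r b.
  by apply: eval_ntest sb; case: hrep.
case: (boolP (ntest r b)) => tb.
  have [k [R' [M' [r' [a' [h le rep' hQ]]]]]] := h1 tb _ _ hrep.
  exists (test_cost b + k).+1, R', M', r', a'; split=> //; last lia.
  by apply: RunIfTrue; rewrite ?hb.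
have [k [R' [M' [r' [a' [h le rep' hQ]]]]]] := h2 tb _ _ hrep.
exists (test_cost b + k).+1, R', M', r', a'; split=> //; last lia.
by apply: RunIfFalse; rewrite ?hb.
Qed.

(** The number that indexes the invariant is a variant. It drops in every iteration, so there are at
    most [N] of them; the failing test at the end accounts for the factor [N.+1]. *)
Lemma awp_while (I : nat -> (nat -> nat) -> (nat -> nat -> nat) -> Prop) b c t N r a Q :
  (forall N r a, I N r a -> nsafe_test r b) ->
  (forall N r a, I N r a -> ntest r b ->
     awp c t r a (fun r' a' => exists2 N', N' < N & I N' r' a')) ->
  (forall N r a, I N r a -> ~~ ntest r b -> Q r a) ->
  I N r a -> awp (AWhile b c) ((t + test_cost b).+1 * N.+1) r a Q.
Proof.
move=> hs hb hQ; elim/ltn_ind: N r a => N IH r a hI R M hrep.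
have ht : eval_test R b = ntest r b by apply: eval_ntest (hs _ _ _ hI); case: hrep.
case: (boolP (ntest r b)) => tb; last first.
  exists (test_cost b).+1, R, M, r, a; split=> //; last exact: hQ hI tb.
    by apply: RunWhileFalse; rewrite ht.
  by rewrite -[X in X <= _]muln1; apply: leq_mul => //; lia.
have [k1 [R1 [M1 [r1 [a1 [h1 le1 rep1 [N' ltN hI']]]]]]] := hb _ _ _ hI tb _ _ hrep.
have [k2 [R2 [M2 [r2 [a2 [h2 le2 rep2 hQ2]]]]]] := IH _ ltN _ _ hI' _ _ rep1.
exists (test_cost b + k1 + k2).+1, R2, M2, r2, a2; split=> //.
  by apply: RunWhileTrue h1 h2; rewrite ht.
have : (t + test_cost b).+1 * N'.+1 <= (t + test_cost b).+1 * N by rewrite leq_mul2l ltN orbT.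
by rewrite mulnS; lia.
Qed.

End Machine.

(** * Composition trees *)

(** Min-plus convolution at [j], restricted to first arguments up to [k]. The separate [k] records
    the progress of the loop that computes it. *)
Fixpoint minsum (f g : nat -> nat) (j k : nat) : nat :=
  if k is k'.+1 then minn (minsum f g j k') (f k + g (j - k)) else f 0 + g j.

Lemma minsum_le f g j k i : i <= k -> minsum f g j k <= f i + g (j - i).
Proof.
elim: k => [|k IH] /=; first by rewrite leqn0 => /eqP->; rewrite subn0.
by rewrite leq_eqVlt => /predU1P[->|/IH]; lia.
Qed.

Lemma minsum_witness f g j k : exists2 i, i <= k & f i + g (j - i) = minsum f g j k.
Proof.
elim: k => [|k [i le_ik IH]] /=; first by exists 0; rewrite ?subn0.
case: (leqP (minsum f g j k) (f k.+1 + g (j - k.+1))) => h; last by exists k.+1.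
by exists i => //; lia.
Qed.

Inductive tree (E : Type) := Leaf of E | Ser of tree E & tree E | Par of tree E & tree E.

Section Trees.
Variables (E : finType) (tau : E -> nat).
Implicit Types (S : {set E}) (T : tree E).

Fixpoint leaves T : seq E :=
  match T with Leaf e => [:: e] | Ser T1 T2 | Par T1 T2 => leaves T1 ++ leaves T2 end.

Fixpoint tree_size T : nat :=
  match T with Leaf _ => 1 | Ser T1 T2 | Par T1 T2 => (tree_size T1 + tree_size T2).+1 end.

(* The entry [j] of the dynamic programming table: the least number of edges to
   delete so that the terminals of [T] are at distance at least [j]. *)
Fixpoint copt T (j : nat) : nat :=
  match T with
  | Leaf e => tau e < j
  | Ser T1 T2 => minsum (copt T1) (copt T2) j j
  | Par T1 T2 => copt T1 j + copt T2 j
  end.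

(* After deletion of [S] the terminals of [T] are at distance at least [j];
   as a predicate in [j] this avoids infinite distances. *)
Fixpoint cut S T (j : nat) : bool :=
  match T with
  | Leaf e => (e \in S) || (j <= tau e)
  | Ser T1 T2 => has (fun i => cut S T1 i && cut S T2 (j - i)) (iota 0 j.+1)
  | Par T1 T2 => cut S T1 j && cut S T2 j
  end.

Lemma cut_serP S T1 T2 j :
  reflect (exists i, [/\ i <= j, cut S T1 i & cut S T2 (j - i)]) (cut S (Ser T1 T2) j).
Proof.
apply: (iffP hasP) => [[i]|[i [le_ij h1 h2]]].
  by rewrite mem_iota => /= lt_ij /andP[h1 h2]; exists i; split=> //; lia.
exists i; last exact/andP.
by have := mem_iota 0 j.+1 i; rewrite add0n ltnS le_ij.
Qed.
Arguments cut : simpl never.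

Lemma cut_leaf S e j : cut S (Leaf e) j = (e \in S) || (j <= tau e). Proof. by []. Qed.

Lemma cut_par S T1 T2 j : cut S (Par T1 T2) j = cut S T1 j && cut S T2 j.
Proof. by []. Qed.

Lemma cut0 S T : cut S T 0.
Proof.
elim: T => [e|T1 h1 T2 h2|T1 h1 T2 h2]; rewrite ?cut_leaf ?cut_par ?orbT ?h1 //.
by apply/cut_serP; exists 0.
Qed.

(** The predicate holds at 0 and fails at [j], so it switches off in between; [i] then stands in for
    the exact distance of the terminals. *)
Lemma cut_last S T j : ~~ cut S T j -> exists i, [/\ i < j, cut S T i & ~~ cut S T i.+1].
Proof.
elim: j => [|j IH]; first by rewrite cut0.
case: (boolP (cut S T j)) => [c nc|/IH[i [lt_ij c nc]] _]; first by exists j.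
by exists i; split=> //; exact: ltnW.
Qed.

(** Counting leaves with multiplicity makes the bound additive over both compositions; distinctness
    of the leaves enters only in the passage to [#|S|]. *)
Lemma copt_count S T j : cut S T j -> copt T j <= count [in S] (leaves T).
Proof.
elim: T j => [e|T1 h1 T2 h2|T1 h1 T2 h2] j; rewrite ?cut_leaf ?cut_par /= ?count_cat.
- by rewrite addn0; case: (e \in S) => //=; [case: (tau e < j) | case: leqP].
- case/cut_serP=> i [le_ij /h1 c1 /h2 c2]; apply: leq_trans (minsum_le _ _ _ le_ij) _.
  exact: leq_add.
- by case/andP=> /h1 c1 /h2 c2; exact: leq_add.
Qed.

Lemma copt_card S T j : uniq (leaves T) -> cut S T j -> copt T j <= #|S|.
Proof.
move=> uT /copt_count h; apply: leq_trans h _.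
rewrite -size_filter cardE; apply: uniq_leq_size; first exact: filter_uniq.
by move=> e; rewrite mem_filter mem_enum => /andP[].
Qed.

(** A binary tree with [k] leaves has [2 * k - 1] nodes. This bounds the iterations of the top-down
    pass. *)
Lemma tree_size_leaves T : tree_size T < 2 * size (leaves T).
Proof. by elim: T => //= T1 h1 T2 h2; rewrite size_cat; lia. Qed.

End Trees.
Arguments cut : simpl never.

(** * Elimination of vertices of degree two *)

Section Reduction.
Variables (V : finType) (s t : V).
Implicit Types (E H : {set V * V}) (u v w x y z : V).

Definition uedge u w : {set V * V} := [set p | (p == (u, w)) || (p == (w, u))].

(** The vertex type stays fixed: [v] is left behind as an isolated vertex. The union merges the new
    edge with an edge [uw] already present. *)
Definition elim_vertex E v u w : {set V * V} :=
  [set p in E | (p.1 != v) && (p.2 != v)] :|: uedge u w.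

Definition degree2 E v u w : Prop :=
  [/\ v != s, v != t, u != w & forall x, ((v, x) \in E) = (x == u) || (x == w)].

Inductive reducible : {set V * V} -> Prop :=
| reducible_edge : reducible (uedge s t)
| reducible_elim E v u w :
    degree2 E v u w -> reducible (elim_vertex E v u w) -> reducible E.

Definition simple_graph E : Prop :=
  (forall x y, ((x, y) \in E) = ((y, x) \in E)) /\ forall x, (x, x) \notin E.

Lemma in_uedge u w x y : ((x, y) \in uedge u w) = (x == u) && (y == w) || (x == w) && (y == u).
Proof. by rewrite !inE !xpair_eqE. Qed.

Lemma in_elim E v u w x y :
  ((x, y) \in elim_vertex E v u w) =
  [&& (x, y) \in E, x != v & y != v] || (x == u) && (y == w) || (x == w) && (y == u).
Proof. by rewrite in_setU in_uedge inE /= orbA. Qed.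

Lemma simple_elim E v u w : u != w -> simple_graph E -> simple_graph (elim_vertex E v u w).
Proof.
move=> uw [symE irrE]; split=> [x y|x]; rewrite !in_elim; last first.
  rewrite (negbTE (irrE x)) /= [(x == w) && _]andbC orbb.
  by apply/andP=> -[/eqP-> /eqP e]; move: uw; rewrite e eqxx.
rewrite symE -!orbA; congr (_ || _); first by rewrite (andbC (y != v)).
by rewrite orbC; congr (_ || _); rewrite andbC.
Qed.

(** Eliminating another vertex keeps an inner vertex [z] at degree one: its neighbour is either kept
    or replaced by the other neighbour of the eliminated vertex. The final edge [st] has no inner
    vertex with a neighbour. *)
Lemma reducible_no_leaf E z q :
  reducible E -> simple_graph E -> z != s -> z != t ->
  ~ (forall x, ((z, x) \in E) = (x == q)).
Proof.
move=> redE; elim: redE z q => [|{}E x y w [xs xt yw nbx] _ IH] z q sgE zs zt nbz.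
  by have := nbz q; rewrite in_uedge (negbTE zs) (negbTE zt) eqxx.
have [symE irrE] := sgE.
have zx : z != x.
  apply: contra yw => /eqP zx; subst z.
  have := nbz y; have := nbz w; rewrite !nbx !eqxx orbT /= => /esym/eqP-> /esym/eqP->.
  by [].
have /IH {}IH := simple_elim x yw sgE.
case: (q =P x) => [qx|/eqP qx]; last first.
  have zE : z != y /\ z != w.
    have : (x, z) \notin E by rewrite symE nbz eq_sym.
    by rewrite nbx negb_or => /andP[].
  case: zE => zy zw; apply: (IH z q zs zt) => p.
  rewrite in_elim (negbTE zy) (negbTE zw) nbz !orbF zx /=.
  by case: (p =P q) => // ->; rewrite qx.
subst q; have : z == y \/ z == w by apply/orP; rewrite -nbx symE nbz.
case=> /eqP ez; subst z.
  apply: (IH y w zs zt) => p; rewrite in_elim nbz eqxx (negbTE yw) /= orbF zx /=.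
  by case: (p =P x) => // ->; rewrite eqxx.
apply: (IH w y zs zt) => p; rewrite in_elim nbz eqxx [w == y]eq_sym (negbTE yw) /= zx /= ?orbF.
by case: (p =P x) => // ->; rewrite eqxx.
Qed.

(** The case of two vertices that are not adjacent. *)
Lemma elim_comm E x y z v u w :
  v != x -> v != y -> v != z -> x != u -> x != w ->
  elim_vertex (elim_vertex E x y z) v u w = elim_vertex (elim_vertex E v u w) x y z.
Proof.
move=> vx vy vz xu xw; apply/setP=> -[p q]; rewrite !in_elim.
have [->|pv] := eqVneq p v.
  by have [->|_] := eqVneq q x; rewrite ?(negbTE vy) ?(negbTE vz) ?(negbTE xu) ?(negbTE xw) ?vx ?eqxx ?(andbF, andbT, andFb, andTb, orbF, orFb).
have [->|qv] := eqVneq q v.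
  by have [->|_] := eqVneq p x; rewrite ?(negbTE vy) ?(negbTE vz) ?(negbTE xu) ?(negbTE xw) ?vx ?eqxx ?(andbF, andbT, andFb, andTb, orbF, orFb).
have [->|px] := eqVneq p x.
  by have [->|_] := eqVneq q v; rewrite ?(negbTE vy) ?(negbTE vz) ?(negbTE xu) ?(negbTE xw) ?vx ?eqxx ?(andbF, andbT, andFb, andTb, orbF, orFb).
have [->|qx] := eqVneq q x.
  by have [->|_] := eqVneq p v; rewrite ?(negbTE vy) ?(negbTE vz) ?(negbTE xu) ?(negbTE xw) ?vx ?eqxx ?(andbF, andbT, andFb, andTb, orbF, orFb).
rewrite !andbT -!orbA; congr (_ || _).
by rewrite orbA orbC -!orbA.
Qed.

(** The case of two adjacent vertices: on a path [y x v w] either order leaves the single edge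
    [yw]. *)
Lemma elim_comm_adj E x y v w :
  x != v -> x != y -> x != w -> v != y -> v != w ->
  elim_vertex (elim_vertex E x v y) v y w = elim_vertex (elim_vertex E v x w) x y w.
Proof.
move=> xv xy xw vy vw; apply/setP=> -[p q]; rewrite !in_elim.
have [->|pv] := eqVneq p v.
  by have [->|_] := eqVneq q x; rewrite ?(negbTE vy) ?(negbTE vw) ?(negbTE xy) ?(negbTE xw) ?[v == x]eq_sym ?(negbTE xv) ?eqxx ?(andbF, andbT, andFb, andTb, orbF, orFb).
have [->|qv] := eqVneq q v.
  by have [->|_] := eqVneq p x; rewrite ?(negbTE vy) ?(negbTE vw) ?(negbTE xy) ?(negbTE xw) ?[v == x]eq_sym ?(negbTE xv) ?eqxx ?(andbF, andbT, andFb, andTb, orbF, orFb).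
have [->|px] := eqVneq p x.
  by have [->|_] := eqVneq q v; rewrite ?(negbTE vy) ?(negbTE vw) ?(negbTE xy) ?(negbTE xw) ?[v == x]eq_sym ?(negbTE xv) ?eqxx ?(andbF, andbT, andFb, andTb, orbF, orFb).
have [->|qx] := eqVneq q x.
  by have [->|_] := eqVneq p v; rewrite ?(negbTE vy) ?(negbTE vw) ?(negbTE xy) ?(negbTE xw) ?[v == x]eq_sym ?(negbTE xv) ?eqxx ?(andbF, andbT, andFb, andTb, orbF, orFb).
by rewrite !(andbT, andbF, orbF).
Qed.

Lemma elim_vertexC E v u w : elim_vertex E v u w = elim_vertex E v w u.
Proof. by congr (_ :|: _); apply/setP=> -[x y]; rewrite !in_uedge orbC. Qed.

Lemma degree2C E v u w : degree2 E v u w -> degree2 E v w u.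
Proof. by case=> vs vt uw nb; split=> // [|x]; [rewrite eq_sym | rewrite nb orbC]. Qed.

(* Confluence: two eliminations commute, also when the two vertices are
   adjacent; the one exception, two adjacent vertices with the same other
   neighbour, would leave an inner vertex of degree one. *)
Lemma reducible_elim_any E v u w :
  reducible E -> simple_graph E -> degree2 E v u w -> reducible (elim_vertex E v u w).
Proof.
move=> redE; elim: redE v u w => [|{}E x y z d2x redE' IH] v u w sgE d2v.
  case: d2v => vs vt _ nbv; have := nbv u.
  by rewrite in_uedge (negbTE vs) (negbTE vt) eqxx.
have [symE irrE] := sgE.
have [xs xt yz nbx] := d2x; have [vs vt uw nbv] := d2v.
have [vx|vx] := eqVneq v x.
  subst x; have yE : y == u \/ y == w by apply/orP; rewrite -nbv nbx eqxx.
  have zE : z == u \/ z == w by apply/orP; rewrite -nbv nbx eqxx orbT.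
  case: yE zE => /eqP ey [] /eqP ez; subst y z; rewrite ?eqxx // in yz *.
  by rewrite elim_vertexC.
have sgx := simple_elim x yz sgE.
(* Since [y] and [z] differ, [v] is at most one of them, and by symmetry not [z]. *)
wlog vNz : y z d2x redE' IH yz nbx sgx / v != z.
  move=> W; have [vz|vz] := eqVneq v z; last exact: (W y z).
  apply: (W z y); rewrite 1?elim_vertexC //; first exact: degree2C.
  - by rewrite eq_sym.
  - by move=> p; rewrite nbx orbC.
  - by subst z; rewrite eq_sym.
have xNv : x != v by rewrite eq_sym.
have [vy|vy] := eqVneq v y; last first.
  have : (v, x) \notin E by rewrite symE nbx negb_or vy.
  rewrite nbv negb_or => /andP[xu xw].
  apply: (@reducible_elim _ x y z).
    split=> // p; rewrite in_elim (negbTE xu) (negbTE xw) !orbF xNv /= nbx.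
    have [->|] //= := eqVneq p v; last by rewrite andbT.
    by rewrite (negbTE vy) (negbTE vNz).
  rewrite -elim_comm //; apply: IH => //; split=> // p.
  rewrite in_elim (negbTE vy) (negbTE vNz) !orbF vx /= nbv.
  by have [->|] //= := eqVneq p x; rewrite ?andbT // (negbTE xu) (negbTE xw).
subst y.
wlog ux : u w d2v uw nbv / u = x.
  move=> W; have : x == u \/ x == w by apply/orP; rewrite -nbv symE nbx eqxx.
  case=> /eqP e; first exact: W.
  rewrite elim_vertexC; apply: W => //; first exact: degree2C.
    by rewrite eq_sym.
  by move=> p; rewrite nbv orbC.
subst u.
(* From here on [x] and [v] are adjacent; the other neighbour of [x] is [z], that of [v] is [w]. *)
have vw : v != w by apply: contra (irrE v) => /eqP e; rewrite nbv -e eqxx orbT.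
have xz : x != z by apply: contra (irrE x) => /eqP e; rewrite nbx -e eqxx orbT.
have nbv' p : ((v, p) \in elim_vertex E x v z) = (p == z) || (p == w).
  rewrite in_elim eqxx (negbTE vNz) orbF vx nbv /= orbC.
  by have [->|] //= := eqVneq p x; rewrite ?andbT ?andbF // (negbTE xz) (negbTE uw).
(* If the outer neighbours coincide, eliminating [x] would leave [v] with the only neighbour [z]. *)
have [zw|zw] := eqVneq z w.
  subst w; case: (@reducible_no_leaf _ v z redE' sgx vs vt) => p.
  by rewrite nbv' orbb.
apply: (@reducible_elim _ x z w).
  split=> // p; rewrite in_elim eqxx (negbTE uw) orbF xNv nbx /= orbC.
  by have [->|] //= := eqVneq p v; rewrite ?andbT ?andbF ?(negbTE vNz) ?(negbTE vw) // orbC.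
by rewrite -elim_comm_adj //; apply: IH.
Qed.

Lemma reducible_terminal E :
  reducible E -> (forall v u w, ~ degree2 E v u w) -> E = uedge s t.
Proof. by case=> // {}E v u w d2 _ /(_ _ _ _ d2). Qed.

End Reduction.

(** * Series-parallel graphs are reducible *)

Lemma joins_ends (G : ttgraph) (e : 'I_(ne G)) : joins e (ends e).1 (ends e).2.
Proof. by rewrite /joins -surjective_pairing eqxx. Qed.

Lemma joinsC (G : ttgraph) (e : 'I_(ne G)) u v : joins e u v = joins e v u.
Proof. by rewrite /joins orbC. Qed.

Lemma joins_inj (G : ttgraph) (e : 'I_(ne G)) u v u' v' :
  joins e u v -> joins e u' v' -> (u = u' /\ v = v') \/ (u = v' /\ v = u').
Proof.
by rewrite /joins => /orP[]/eqP-> /orP[]/eqP[-> ->]; [left | right | right | left].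
Qed.

Section Gluing.
Variables (G1 G2 G : ttgraph).
Variables (f : 'I_(nv G1) + 'I_(nv G2) -> 'I_(nv G)).
Variables (g : 'I_(ne G1) + 'I_(ne G2) -> 'I_(ne G)).
Variable ps : seq (('I_(nv G1) + 'I_(nv G2)) * ('I_(nv G1) + 'I_(nv G2))).
Hypothesis glue : is_gluing f g ps.
Hypothesis ps_cross : forall x y, (x, y) \in ps -> exists a b, x = inl a /\ y = inr b.

Lemma gluing_injl : injective (f \o inl).
Proof.
case: glue => -[_ eqf] _ _ _ x y /eqf[[//]|/ps_cross[a [b []//]]|/ps_cross[a [b []//]]].
Qed.

Lemma gluing_injr : injective (f \o inr).
Proof.
case: glue => -[_ eqf] _ _ _ x y /eqf[[//]|/ps_cross[a [b []//]]|/ps_cross[a [b []//]]].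
Qed.

Lemma gluing_cross x y : f (inl x) = f (inr y) -> (inl x, inr y) \in ps.
Proof. by case: glue => -[_ eqf] _ _ _ /eqf[//|//|/ps_cross[a [b []//]]]. Qed.

Lemma gluing_ne : ne G = ne G1 + ne G2.
Proof.
case: glue => _ /bij_eq_card; rewrite card_sum !card_ord => h _ _.
by rewrite h.
Qed.

Lemma gluing_nv : nv G <= nv G1 + nv G2.
Proof.
case: glue => -[surj _] _ _ _.
rewrite -[nv G]card_ord -[nv G1]card_ord -[nv G2]card_ord -card_sum.
apply: leq_trans (leq_image_card f _).
apply: subset_leq_card; apply/subsetP => v _.
by have [a <-] := surj v; apply: image_f.
Qed.

Lemma gluing_loopless :
  (forall e : 'I_(ne G1), (ends e).1 != (ends e).2) ->
  (forall e : 'I_(ne G2), (ends e).1 != (ends e).2) ->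
  forall e : 'I_(ne G), (ends e).1 != (ends e).2.
Proof.
move=> h1 h2 e; case: glue => _ [g' _ gK] j1 j2; rewrite -(gK e).
case: (g' e) => e'.
  apply: contraNneq (h1 e') => e12; apply/eqP/gluing_injl => /=.
  by case: (joins_inj (joins_ends (g (inl e'))) (j1 e')) => -[<- <-].
apply: contraNneq (h2 e') => e12; apply/eqP/gluing_injr => /=.
by case: (joins_inj (joins_ends (g (inr e'))) (j2 e')) => -[<- <-].
Qed.

End Gluing.

(** The parts of a composition have vertex types of their own; mapping them into one fixed type lets
    them be treated as subgraphs of a common graph. *)
Definition image_edges (G : ttgraph) (V : finType) (phi : 'I_(nv G) -> V) : {set V * V} :=
  [set (phi uv.1, phi uv.2) | uv in [pred uv | [exists e : 'I_(ne G), joins e uv.1 uv.2]]].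

Lemma image_edgesP (G : ttgraph) (V : finType) (phi : 'I_(nv G) -> V) x y :
  reflect (exists e u v, [/\ @joins G e u v, x = phi u & y = phi v])
          ((x, y) \in image_edges phi).
Proof.
apply: (iffP imsetP) => [[[u v]]|[e [u [v [j -> ->]]]]].
  by rewrite inE /= => /existsP[e j] [-> ->]; exists e, u, v.
by exists (u, v) => //; rewrite inE /=; apply/existsP; exists e.
Qed.

Lemma image_edges_gluing G1 G2 G f g ps (V : finType) (phi : 'I_(nv G) -> V) :
  @is_gluing G1 G2 G f g ps ->
  image_edges phi = image_edges (phi \o (f \o inl)) :|: image_edges (phi \o (f \o inr)).
Proof.
case=> _ [g' _ gK] j1 j2; apply/setP=> -[x y]; rewrite inE; apply/image_edgesP/orP.
  case=> e [u [v [j -> ->]]]; rewrite -(gK e) in j; case: (g' e) j => e' j.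
    left; apply/image_edgesP; have [[-> ->]|[-> ->]] := joins_inj j (j1 e').
      by exists e', (ends e').1, (ends e').2; split=> //; exact: joins_ends.
    by exists e', (ends e').2, (ends e').1; split=> //; rewrite joinsC; exact: joins_ends.
  right; apply/image_edgesP; have [[-> ->]|[-> ->]] := joins_inj j (j2 e').
    by exists e', (ends e').1, (ends e').2; split=> //; exact: joins_ends.
  by exists e', (ends e').2, (ends e').1; split=> //; rewrite joinsC; exact: joins_ends.
case=> /image_edgesP[e [u [v [j -> ->]]]].
  exists (g (inl e)), (f (inl u)), (f (inl v)); split=> //.
  by have := j1 e; have [[-> ->]|[-> ->]] := joins_inj j (joins_ends e); rewrite // joinsC.
exists (g (inr e)), (f (inr u)), (f (inr v)); split=> //.
by have := j2 e; have [[-> ->]|[-> ->]] := joins_inj j (joins_ends e); rewrite // joinsC.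
Qed.

Lemma serial_cross (A B : eqType) (a : A) (b : B) (x y : A + B) :
  (x, y) \in [:: (inl a, inr b)] -> exists a b, x = inl a /\ y = inr b.
Proof. by rewrite inE => /eqP[-> ->]; exists a, b. Qed.

Lemma parallel_cross (A B : eqType) (a a' : A) (b b' : B) (x y : A + B) :
  (x, y) \in [:: (inl a, inr b); (inl a', inr b')] -> exists a b, x = inl a /\ y = inr b.
Proof.
by rewrite !inE => /orP[] /eqP[-> ->]; [exists a, b | exists a', b'].
Qed.

Lemma series_parallel_loopless G :
  series_parallel G -> forall e : 'I_(ne G), (ends e).1 != (ends e).2.
Proof.
elim=> {G} [G [_ _ j]|G1 G2 G _ h1 _ h2 [f [g [gl _ _]]]|G1 G2 G _ h1 _ h2 [f [g [gl _ _]]]].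
- move=> e; have := source_neq_sink G.
  by have [[-> ->]|[-> ->]] := joins_inj (joins_ends e) (j e); rewrite // eq_sym.
- exact: (gluing_loopless gl (@serial_cross _ _ _ _) h1 h2).
- exact: (gluing_loopless gl (@parallel_cross _ _ _ _ _ _) h1 h2).
Qed.

(** Edges add up under composition, while vertices add up at most, so the ratio of a single edge
    persists. This turns bounds in the number of vertices into bounds in the number of edges. *)
Lemma series_parallel_nv G : series_parallel G -> nv G <= 2 * ne G.
Proof.
elim=> {G} [G [e1 e2 _]|G1 G2 G _ h1 _ h2 [f [g [gl _ _]]]|G1 G2 G _ h1 _ h2 [f [g [gl _ _]]]].
- by rewrite e1 e2.
- by have := gluing_nv gl; rewrite (gluing_ne gl); lia.
- by have := gluing_nv gl; rewrite (gluing_ne gl); lia.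
Qed.

(** The induction needs a context: [phi] places [G] next to further edges [H] that touch it only at
    its terminals, and there [G] may be exchanged for one edge between them. In a composition each
    part is treated with the other one in its context. *)
Lemma series_parallel_reducible_frame (V : finType) (s0 t0 : V) G :
  series_parallel G -> forall (phi : 'I_(nv G) -> V) (H : {set V * V}), injective phi ->
  (forall v, v != source G -> v != sink G ->
     [/\ phi v != s0, phi v != t0 & forall y, ((phi v, y) \notin H) && ((y, phi v) \notin H)]) ->
  reducible s0 t0 (H :|: uedge (phi (source G)) (phi (sink G))) ->
  reducible s0 t0 (H :|: image_edges phi).
Proof.
elim=> {G} [G [_ ne1 j]|G1 G2 G _ h1 _ h2 [f [g [gl es et]]]|G1 G2 G _ h1 _ h2 [f [g [gl es et]]]] phi H phi_inj inner.
- suff -> : image_edges phi = uedge (phi (source G)) (phi (sink G)) by [].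
  apply/setP=> -[x y]; rewrite in_uedge; apply/image_edgesP/orP.
    case=> e [u [v [juv -> ->]]].
    by have [[-> ->]|[-> ->]] := joins_inj juv (j e); [left | right]; rewrite !eqxx.
  have e : 'I_(ne G) by rewrite ne1; exact: ord0.
  case=> /andP[/eqP-> /eqP->]; first by exists e, (source G), (sink G).
  by exists e, (sink G), (source G); rewrite joinsC.
- have ic := @serial_cross _ _ (sink G1) (source G2).
  have cross := gluing_cross gl ic.
  have inj1 := gluing_injl gl ic; have inj2 := gluing_injr gl ic.
  have {}cross x y : f (inl x) = f (inr y) -> x = sink G1 /\ y = source G2.
    by move/cross; rewrite inE => /eqP[].
  rewrite (image_edges_gluing phi gl) => hred.
  set m := f (inl (sink G1)).
  have em : m = f (inr (source G2)).
    by case: gl => -[_ eqf] _ _ _; apply/eqf; constructor 2; rewrite inE.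
  have ms : m != source G.
    by rewrite es; apply: contraNneq (source_neq_sink G1) => /inj1->.
  have mt : m != sink G.
    by rewrite et em; apply: contraNneq (source_neq_sink G2) => /inj2->.
  rewrite setUA setUAC; apply: h1 => [x y /phi_inj/inj1//|v vs vt|].
    have [|| ? ? hH] := inner (f (inl v)).
    + by rewrite es; apply: contraNneq vs => /inj1->.
    + by rewrite et; apply: contraNneq vt => /cross[-> _].
    split=> // y; have /andP[n1 n2] := hH y; rewrite !inE !negb_or n1 n2 /=.
    apply/andP; split; apply/image_edgesP => -[e [a [b [_ ea eb]]]].
      by case/phi_inj/cross: ea => ev; rewrite ev eqxx in vt.
    by case/phi_inj/cross: eb => ev; rewrite ev eqxx in vt.
  rewrite setUAC; apply: h2 => [x y /phi_inj/inj2//|v vs vt|].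
    have [|| ? ? hH] := inner (f (inr v)).
    + by rewrite es; apply: contraNneq vs => /esym/cross[_ ->].
    + by rewrite et; apply: contraNneq vt => /inj2->.
    split=> // y; have /andP[n1 n2] := hH y; rewrite [in X in X && _]inE [in X in _ && X]inE.
    rewrite !negb_or n1 n2 /= !in_uedge /= !(inj_eq phi_inj).
    have /negbTE-> : f (inr v) != f (inl (source G1)).
      by apply: contraNneq vs => /esym/cross[_ ->].
    have /negbTE-> : f (inr v) != f (inl (sink G1)).
      by apply: contraNneq vs => /esym/cross[_ ->].
    by rewrite !andbF.
  rewrite /= -et -es -em -/m.
  have [mNs mNt mH] := inner m ms mt.
  have st : phi (source G) != phi (sink G) by rewrite (inj_eq phi_inj) source_neq_sink.
  (* Both parts have become single edges, so the glued vertex has degree two. *)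
  apply: (@reducible_elim _ _ _ _ (phi m) (phi (source G)) (phi (sink G))).
    split=> // x; have /andP[n1 n2] := mH x.
    rewrite !in_setU !in_uedge (negbTE n1) eqxx !(inj_eq phi_inj) (negbTE ms) (negbTE mt) /=.
    by rewrite !orbF.
  suff -> : elim_vertex (H :|: uedge (phi (source G)) (phi m) :|: uedge (phi m) (phi (sink G)))
    (phi m) (phi (source G)) (phi (sink G)) = H :|: uedge (phi (source G)) (phi (sink G)) by [].
  apply/setP=> -[x y]; rewrite in_elim !in_setU !in_uedge -orbA; congr (_ || _).
  have [->|xm] := eqVneq x (phi m).
    by have /andP[/negbTE-> _] := mH y; rewrite !andbF.
  have [->|ym] := eqVneq y (phi m).
    by have /andP[_ /negbTE->] := mH x; rewrite !andbF.
  by rewrite !(andbF, andbT, orbF).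
- have ic := @parallel_cross _ _ (source G1) (sink G1) (source G2) (sink G2).
  have cross := gluing_cross gl ic.
  have inj1 := gluing_injl gl ic; have inj2 := gluing_injr gl ic.
  have {}cross x y : f (inl x) = f (inr y) ->
      (x == source G1) && (y == source G2) || (x == sink G1) && (y == sink G2).
    by move/cross; rewrite !inE => /orP[] /eqP[-> ->]; rewrite !eqxx ?orbT.
  have es2 : source G = f (inr (source G2)).
    by rewrite es; case: gl => -[_ eqf] _ _ _; apply/eqf; constructor 2; rewrite inE eqxx.
  have et2 : sink G = f (inr (sink G2)).
    by rewrite et; case: gl => -[_ eqf] _ _ _; apply/eqf; constructor 2; rewrite !inE eqxx orbT.
  rewrite (image_edges_gluing phi gl) => hred.
  rewrite setUA setUAC; apply: h1 => [x y /phi_inj/inj1//|v vs vt|].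
    have [|| ? ? hH] := inner (f (inl v)).
    + by rewrite es; apply: contraNneq vs => /inj1->.
    + by rewrite et; apply: contraNneq vt => /inj1->.
    split=> // y; have /andP[n1 n2] := hH y; rewrite !inE !negb_or n1 n2 /=.
    apply/andP; split; apply/image_edgesP => -[e [a [b [_ ea eb]]]].
      by move/phi_inj/cross: ea; rewrite (negbTE vs) (negbTE vt).
    by move/phi_inj/cross: eb; rewrite (negbTE vs) (negbTE vt).
  rewrite /= -es -et setUAC; apply: h2 => [x y /phi_inj/inj2//|v vs vt|].
    have vs' : f (inr v) != source G by rewrite es2; apply: contraNneq vs => /inj2->.
    have vt' : f (inr v) != sink G by rewrite et2; apply: contraNneq vt => /inj2->.
    have [? ? hH] := inner (f (inr v)) vs' vt'.
    split=> // y; have /andP[n1 n2] := hH y; rewrite [in X in X && _]inE [in X in _ && X]inE.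
    rewrite !negb_or n1 n2 /= !in_uedge /= !(inj_eq phi_inj) (negbTE vs') (negbTE vt').
    by rewrite !andbF.
  (* Both parts have become the same edge, and the set of edges absorbs the second copy. *)
  by rewrite /= -es2 -et2 -setUA setUid.
Qed.

Lemma series_parallel_reducible G :
  series_parallel G -> reducible (source G) (sink G) (image_edges (@id 'I_(nv G))).
Proof.
move=> spG; rewrite -[image_edges _]set0U.
apply: (series_parallel_reducible_frame spG) => // [v vs vt|].
  by split=> // y; rewrite !inE.
by rewrite set0U; exact: reducible_edge.
Qed.

(** * Distances in the reduced graph *)

(** The absolute difference: one of the two truncated subtractions is 0. *)
Definition gap (a b : nat) : nat := (a - b) + (b - a).

Section State.
Variables (G : ttgraph) (tau : 'I_(ne G) -> nat).
Notation V := 'I_(nv G).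
Notation E := 'I_(ne G).
Implicit Types (S : {set E}) (T : tree E) (x y u v w : V) (p q : seq (E * V)).

Lemma path_length_cons e v p : path_length tau ((e, v) :: p) = tau e + path_length tau p.
Proof. by rewrite /path_length big_cons. Qed.

Lemma walk_cat S x p y q z :
  is_walk S x p y -> is_walk S y q z -> is_walk S x (p ++ q) z.
Proof.
elim: p x => [|[e v] p IH] x /=; first by move/eqP->.
by case/and3P=> -> -> /IH h /h.
Qed.

Lemma walk_rev S x p y :
  is_walk S x p y -> exists2 q, is_walk S y q x & path_length tau q = path_length tau p.
Proof.
elim: p x => [|[e v] p IH] x /=; first by move/eqP->; exists [::] => /=.
case/and3P=> eS jxv /IH[q wq lq]; exists (q ++ [:: (e, x)]).
  by apply: walk_cat wq _; rewrite /= eS joinsC jxv eqxx.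
rewrite /path_length big_cat big_cons big_nil /= addn0 addnC.
by rewrite big_cons /=; congr (_ + _); exact: lq.
Qed.

Lemma walk_suffix S x p y z :
  is_walk S x p y -> uniq (x :: [seq ev.2 | ev <- p]) -> z \in x :: [seq ev.2 | ev <- p] ->
  exists q, [/\ is_walk S z q y, uniq (z :: [seq ev.2 | ev <- q]) &
                path_length tau q <= path_length tau p].
Proof.
elim: p x => [|[e v] p IH] x wp up; first by rewrite inE => /eqP->; exists [::].
rewrite inE => /predU1P[->|zp]; first by exists ((e, v) :: p).
have [_ _ wp'] := and3P wp; have [q [wq uq lq]] := IH v wp' (andP up).2 zp.
by exists q; split=> //; rewrite path_length_cons; lia.
Qed.

(** Feasibility speaks of simple paths, but concatenation along trees yields walks; cutting out
    closed parts bridges the two. *)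
Lemma walk_shorten S x p y :
  is_walk S x p y ->
  exists q, [/\ is_walk S x q y, uniq (x :: [seq ev.2 | ev <- q]) &
                path_length tau q <= path_length tau p].
Proof.
elim: p x => [|[e v] p IH] x; first by exists [::].
case/and3P=> eS jxv /IH[q [wq uq lq]].
have [xq|xq] := boolP (x \in v :: [seq ev.2 | ev <- q]).
  have [q' [wq' uq' lq']] := walk_suffix wq uq xq.
  by exists q'; split=> //; rewrite path_length_cons; lia.
exists ((e, v) :: q); split; rewrite ?path_length_cons ?leq_add2l //.
  by rewrite /= eS jxv.
by rewrite cons_uniq xq.
Qed.

Definition short_walk S x y (j : nat) : Prop :=
  exists2 p, is_walk S x p y & path_length tau p < j.

Lemma short_walkC S x y j : short_walk S x y j -> short_walk S y x j.
Proof. by case=> p /walk_rev[q wq <-] lp; exists q. Qed.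

Lemma short_walk_feasible S (l : nat) :
  feasible tau (Posz l) S -> ~ short_walk S (source G) (sink G) l.
Proof.
move=> fS [p /walk_shorten[q [wq uq lq]] lp].
have /fS : is_st_path S q by rewrite /is_st_path wq.
by rewrite lez_nat; lia.
Qed.

(* [g u v] is the composition tree of the part of [G] that the edge [uv] of the
   current simple graph stands for. *)
Implicit Types g : V -> V -> option (tree E).

Definition edge_set g : {set V * V} := [set p | isSome (g p.1 p.2)].

Definition delete g v := fun x y => if (x == v) || (y == v) then None else g x y.

Definition insert g u w T := fun x y =>
  if (x == u) && (y == w) || (x == w) && (y == u)
  then Some (if g u w is Some T' then Par T' T else T) else g x y.

Lemma in_edge_set g x y : ((x, y) \in edge_set g) = isSome (g x y).
Proof. by rewrite inE. Qed.

Lemma edge_set_insert g u w T : edge_set (insert g u w T) = edge_set g :|: uedge u w.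
Proof.
apply/setP=> -[x y]; rewrite in_setU !in_edge_set in_uedge /insert.
by case: ifP => _; rewrite ?orbT ?orbF.
Qed.

Lemma edge_set_elim g v u w T :
  edge_set (insert (delete g v) u w T) = elim_vertex (edge_set g) v u w.
Proof.
rewrite edge_set_insert; congr (_ :|: _); apply/setP=> -[x y].
rewrite in_edge_set !inE /delete /=; case: (x == v) => /=; first by rewrite andbF.
by case: (y == v); rewrite /= ?andbF ?andbT.
Qed.

(** Here [i] is the number of input edges read so far. Disjointness of different trees is kept
    because it makes the leaves of a composed tree distinct, which optimality relies on. *)
Record tree_graph (i : nat) g : Prop := TreeGraph {
  tg_sym : forall u v, g u v = g v u;
  tg_irr : forall u, g u u = None;
  tg_uniq : forall u v T, g u v = Some T -> uniq (leaves T);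
  tg_disj : forall u v u' v' T T' e, g u v = Some T -> g u' v' = Some T' ->
    e \in leaves T -> e \in leaves T' -> (u = u' /\ v = v') \/ (u = v' /\ v = u');
  tg_lt : forall u v T e, g u v = Some T -> e \in leaves T -> e < i;
  tg_walk : forall S u v T j, g u v = Some T -> ~~ cut tau S T j -> short_walk S u v j }.

(** A Lipschitz condition: the distance across a tree is at least the difference of the potentials
    at its ends. *)
Definition fits S g (pi : V -> nat) : Prop :=
  forall u v T, g u v = Some T -> cut tau S T (gap (pi u) (pi v)).

(* Potentials of the current graph extend to potentials of the first [i] edges
   of [G]; this bounds distances from below, [tg_walk] from above. *)
Definition extends (i : nat) g : Prop :=
  forall S pi, fits S g pi ->
  exists pi' : V -> nat,
    [/\ pi' (source G) = pi (source G), pi' (sink G) = pi (sink G) &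
        forall e : E, e < i -> cut tau S (Leaf e) (gap (pi' (ends e).1) (pi' (ends e).2))].

Lemma simple_edge_set i g : tree_graph i g -> simple_graph (edge_set g).
Proof.
by case=> symg irrg _ _ _ _; split=> [x y|x]; rewrite !in_edge_set 1?symg ?irrg.
Qed.

Lemma tree_graph_delete i g v : tree_graph i g -> tree_graph i (delete g v).
Proof.
case=> symg irrg ug dg lg wg.
have gE u w T : delete g v u w = Some T -> g u w = Some T.
  by rewrite /delete; case: ifP.
split.
- by move=> x y; rewrite /delete orbC symg.
- by move=> x; rewrite /delete irrg; case: ifP.
- by move=> x y T /gE/ug.
- by move=> x y x' y' T T' e /gE h /gE; apply: dg h.
- by move=> x y T e /gE; exact: lg.
- by move=> S x y T j /gE; exact: wg.
Qed.

Lemma tree_graph_insert i g u w T :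
  tree_graph i g -> u != w -> uniq (leaves T) ->
  (forall e, e \in leaves T -> e < i) ->
  (forall x y T' e, g x y = Some T' -> e \in leaves T -> e \notin leaves T') ->
  (forall S j, ~~ cut tau S T j -> short_walk S u w j) ->
  tree_graph i (insert g u w T).
Proof.
case=> symg irrg ug dg lg wg uw uT lT dT wT.
have gE x y T' : insert g u w T x y = Some T' ->
  (((x = u /\ y = w) \/ (x = w /\ y = u)) /\
   ((g u w = None /\ T' = T) \/ exists2 T0, g u w = Some T0 & T' = Par T0 T)) \/
  ((x, y) \notin uedge u w /\ g x y = Some T').
  rewrite /insert in_uedge; case: ifP => [h|_ h]; last by right.
  move=> [<-]; left; split.
    by case/orP: h => /andP[/eqP-> /eqP->]; [left | right].
  by case: (g u w) => [T0|]; [right; exists T0 | left].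
split.
- move=> x y; rewrite /insert symg [g x y]symg.
  by rewrite [(y == u) && _]andbC [(y == w) && _]andbC orbC.
- move=> x; rewrite /insert irrg [(x == w) && _]andbC orbb; case: ifP => // /andP[/eqP-> /eqP e].
  by rewrite e eqxx in uw.
- move=> x y T' /gE[[_ [[_ ->]|[T0 g0 ->]]]|[_ /ug]] //=.
  rewrite cat_uniq uT (ug _ _ _ g0) /= andbT; apply/hasPn => e eT.
  exact: dT g0 eT.
- move=> x y x' y' T1 T2 e /gE h1 /gE h2 e1 e2.
  have old a b T' : g a b = Some T' -> e \in leaves T' -> e \notin leaves T.
    by move=> gab eT'; apply: contraL eT' => eT; exact: dT gab eT.
  case: h1 h2 => [[xy h1]|[nxy h1]] [[xy' h2]|[nxy' h2]].
  + by case: xy xy' => [] [-> ->] [] [-> ->]; auto.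
  + have eT := old _ _ _ h2 e2.
    case: h1 => [[_ ?]|[T0 g0 ?]]; subst T1; first by rewrite e1 in eT.
    rewrite /= mem_cat (negbTE eT) orbF in e1.
    case: (dg _ _ _ _ _ _ _ g0 h2 e1 e2) => -[? ?]; subst x' y';
      by rewrite in_uedge !eqxx ?orbT in nxy'.
  + have eT := old _ _ _ h1 e1.
    case: h2 => [[_ ?]|[T0 g0 ?]]; subst T2; first by rewrite e2 in eT.
    rewrite /= mem_cat (negbTE eT) orbF in e2.
    case: (dg _ _ _ _ _ _ _ g0 h1 e2 e1) => -[? ?]; subst x y;
      by rewrite in_uedge !eqxx ?orbT in nxy.
  + exact: dg h1 h2 e1 e2.
- move=> x y T' e /gE[[_ [[_ ->]|[T0 g0 ->]]]|[_ h]] /=; first exact: lT.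
    by rewrite mem_cat => /orP[/(lg _ _ _ _ g0)|/lT].
  exact: lg h.
- move=> S x y T' j /gE[[xy hT]|[_ h]]; last exact: wg h.
  move=> nc; suff : short_walk S u w j by case: xy => -[-> ->] // /short_walkC.
  case: hT nc => [[_ ->]|[T0 g0 ->]]; first exact: wT.
  by rewrite cut_par negb_and => /orP[/(wg _ _ _ _ _ g0)|/wT].
Qed.

Lemma gapC a b : gap a b = gap b a. Proof. by rewrite /gap addnC. Qed.

Lemma fits_insert i S g pi u w T :
  tree_graph i g -> fits S (insert g u w T) pi ->
  fits S g pi /\ cut tau S T (gap (pi u) (pi w)).
Proof.
case=> symg _ _ _ _ _ fg.
have := fg u w; rewrite {1}/insert !eqxx /= => /(_ _ (erefl _)) cuw.
split; last by case: (g u w) cuw => // T0; rewrite cut_par => /andP[].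
move=> x y T' gxy; have := fg x y; rewrite /insert; case: ifP => [h _|_]; last exact.
have guw : g u w = Some T' by case/orP: h gxy => /andP[/eqP-> /eqP->] //; rewrite symg.
move: cuw; rewrite guw cut_par => /andP[cuw _].
by case/orP: h => /andP[/eqP-> /eqP->] //; rewrite gapC.
Qed.

(** The form that [extends] takes while edges are being read: no vertex has been eliminated, so the
    potential itself serves. *)
Definition covers (i : nat) g : Prop :=
  forall S pi, fits S g pi ->
  forall e : E, e < i -> cut tau S (Leaf e) (gap (pi (ends e).1) (pi (ends e).2)).

Lemma covers_extends i g : covers i g -> extends i g.
Proof. by move=> cg S pi /cg h; exists pi; split. Qed.

Lemma covers_insert (e : E) g :
  tree_graph e g -> covers e g ->
  covers e.+1 (insert g (ends e).1 (ends e).2 (Leaf e)).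
Proof.
move=> tg cg S pi /(fits_insert tg)[/cg h he] e'.
by rewrite ltnS leq_eqVlt => /predU1P[/val_inj->|/h].
Qed.

Lemma tree_graph_insert_leaf (e : E) g :
  tree_graph e g -> (ends e).1 != (ends e).2 ->
  tree_graph e.+1 (insert g (ends e).1 (ends e).2 (Leaf e)).
Proof.
move=> tg loop; apply: tree_graph_insert => //=.
- by case: tg => ? ? ? ? lg ?; split=> // u v T e' gT eT; apply: ltnW; exact: lg gT eT.
- by move=> e'; rewrite inE => /eqP->.
- move=> x y T' e' gT'; rewrite inE => /eqP->; apply/negP => /(tg_lt tg gT').
  by rewrite ltnn.
- move=> S j; rewrite cut_leaf negb_or -ltnNge => /andP[eS lt_j].
  exists [:: (e, (ends e).2)]; last by rewrite path_length_cons /path_length big_nil addn0.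
  by rewrite /= eS joins_ends eqxx.
Qed.

Section Elimination.
Variables (i : nat) (g : V -> V -> option (tree E)) (v u w : V) (Tu Tw : tree E).
Hypotheses (tg : tree_graph i g) (d2 : degree2 (source G) (sink G) (edge_set g) v u w).
Hypotheses (gu : g u v = Some Tu) (gw : g w v = Some Tw).

Let uv : u != v.
Proof. by apply/eqP=> e; move: gu; rewrite e (tg_irr tg). Qed.

Let wv : w != v.
Proof. by apply/eqP=> e; move: gw; rewrite e (tg_irr tg). Qed.

Lemma tree_graph_elim : tree_graph i (insert (delete g v) u w (Ser Tu Tw)).
Proof.
have [_ _ uw _] := d2.
apply: tree_graph_insert; rewrite ?uw //=.
- exact: tree_graph_delete.
- rewrite cat_uniq (tg_uniq tg gu) (tg_uniq tg gw) andbT /=; apply/hasPn => e ew.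
  apply/negP => eu; case: (tg_disj tg gu gw eu ew) => -[a b]; last by move: uv; rewrite a eqxx.
  by rewrite a eqxx in uw.
- by move=> e; rewrite mem_cat => /orP[/(tg_lt tg gu)|/(tg_lt tg gw)].
- move=> x y T' e; rewrite /delete; case: ifP => // /norP[xv yv] gT'; rewrite mem_cat => eT.
  apply/negP => eT'; case/orP: eT => eT.
    by case: (tg_disj tg gu gT' eT eT') => -[a b]; rewrite -b eqxx in xv yv.
  by case: (tg_disj tg gw gT' eT eT') => -[a b]; rewrite -b eqxx in xv yv.
- move=> S j nc.
  have [cj|ncj] := boolP (cut tau S Tu j).
    by case/cut_serP: nc; exists j; split=> //; rewrite subnn; exact: cut0.
  (* A walk of length at most [k] through [Tu] and one of length below [j - k] through [Tw] make up
     less than [j]. *)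
  have [k [lt_kj ck nck]] := cut_last ncj.
  have [p wp lp] := tg_walk tg gu nck.
  have [|q wq lq] := short_walkC (tg_walk tg gw (S := S) (j := j - k) _).
    by apply: contra nc => cw; apply/cut_serP; exists k; split=> //; exact: ltnW.
  exists (p ++ q); first exact: walk_cat wp wq.
  by move: lp lq; rewrite /path_length big_cat /=; lia.
Qed.

Lemma extends_elim : extends i g -> extends i (insert (delete g v) u w (Ser Tu Tw)).
Proof.
have [vs vt uw nbv] := d2.
move=> eg S pi /(fits_insert (tree_graph_delete v tg))[fg /cut_serP[k [le_k ck cdk]]].
(* The serial cut splits the gap between [u] and [w] at [k]; accordingly [v] is placed at distance
   [k] from [u] in the direction of [w]. *)
pose mid := if pi u <= pi w then pi u + k else pi u - k.
pose pi1 x := if x == v then mid else pi x.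
have gapu : gap (pi u) mid = k by move: le_k; rewrite /gap /mid; case: ifP; lia.
have gapw : gap (pi w) mid = gap (pi u) (pi w) - k.
  by move: le_k; rewrite /gap /mid; case: ifP; lia.
have f1 x T : g x v = Some T -> cut tau S T (gap (pi x) mid).
  move=> gxv; have : (v, x) \in edge_set g by rewrite in_edge_set (tg_sym tg) gxv.
  rewrite nbv => /orP[]/eqP ex; subst x.
    by move: gxv; rewrite gu gapu => -[<-].
  by move: gxv; rewrite gw gapw => -[<-].
have [|pi' [es et h]] := eg S pi1.
  move=> x y T gxy; rewrite /pi1; have [xv|xv] := eqVneq x v.
    have [yv|yv] := eqVneq y v; first by move: gxy; rewrite xv yv (tg_irr tg).
    by rewrite gapC; apply: f1; rewrite -xv (tg_sym tg).
  have [yv|yv] := eqVneq y v; first by apply: f1; rewrite -yv.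
  by apply: fg; rewrite /delete (negbTE xv) (negbTE yv).
exists pi'; split=> //.
  by rewrite es /pi1 eq_sym (negbTE vs).
by rewrite et /pi1 eq_sym (negbTE vt).
Qed.

End Elimination.

Lemma feasible_cut g T (l : nat) S :
  tree_graph (ne G) g -> extends (ne G) g -> edge_set g = uedge (source G) (sink G) ->
  g (source G) (sink G) = Some T -> feasible tau (Posz l) S <-> cut tau S T l.
Proof.
move=> tg eg sg gT; split=> [fS|cl].
  by apply/negPn/negP => /(tg_walk tg gT)/(short_walk_feasible fS).
have ts : (sink G == source G) = false by rewrite eq_sym (negbTE (source_neq_sink G)).
(* The potential with [l] at the sink and 0 elsewhere fits the one remaining edge. Its extension to
   [G] grows along a walk by at most the length of the walk. *)
have [|pi [pis pit hpi]] := eg S (fun x => if x == sink G then l else 0).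
  move=> x y T' gxy; have : (x, y) \in edge_set g by rewrite in_edge_set gxy.
  have gl : gap 0 l = l by rewrite /gap; lia.
  rewrite sg in_uedge => /orP[]/andP[/eqP ex /eqP ey]; subst x y; move: gxy.
    by rewrite gT eqxx eq_sym ts gl => -[<-].
  by rewrite (tg_sym tg) gT eqxx eq_sym ts gapC gl => -[<-].
rewrite eqxx eq_sym ts in pis pit.
have hw x p y : is_walk S x p y -> pi y <= pi x + path_length tau p.
  elim: p x => [|[e v] p IH] x /=; first by move/eqP->; exact: leq_addr.
  case/and3P=> eS jxv /IH; rewrite path_length_cons.
  have := hpi e (ltn_ord e); rewrite cut_leaf (negbTE eS) /= /gap.
  by have [[-> ->]|[-> ->]] := joins_inj jxv (joins_ends e); lia.
by move=> p /andP[/hw + _]; rewrite pis pit add0n lez_nat.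
Qed.

Lemma feasible_minimum g T (l : nat) S :
  tree_graph (ne G) g -> extends (ne G) g -> edge_set g = uedge (source G) (sink G) ->
  g (source G) (sink G) = Some T -> cut tau S T l -> #|S| = copt tau T l ->
  min_cost_solution tau (Posz l) S.
Proof.
move=> tg eg sg gT cS eS; have fc S' := feasible_cut l S' tg eg sg gT.
split=> [|S' /fc cS']; first exact/fc.
by rewrite eS; apply: copt_card cS'; exact: tg_uniq tg _ _ _ gT.
Qed.

End State.

(** * The program *)

(* Registers: 0 base of the arrays, 1 number of vertices, 2 number of edges,
   3 source, 4 sink, 5 l, 6 first free node, 7 stack height; the others are
   scratch.  Arrays: 0 degree, 1 sum of the neighbours, 2 some neighbour,
   3 row offset of the adjacency matrix, 4 adjacency matrix (0 or a node),
   5 stack of vertices, 6-9 table, kind, left and right child of a node,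
   10 and 11 stack of nodes with their targets. *)
Local Notation "# n" := (Cst (Posz n)) (at level 0, n at level 0).
Local Notation "$ n" := (Reg n) (at level 0, n at level 0).
Local Notation "e1 :+ e2" := (Add e1 e2) (at level 50, left associativity).
Local Notation "e1 :- e2" := (Defs.Sub e1 e2) (at level 50, left associativity).
Local Notation "c1 ;; c2" := (ASeq c1 c2) (at level 90, right associativity).

(** * Tree nodes and their tables *)

Definition fill_table (entry : acmd) : acmd :=
  ASet 15 #0 ;;
  AWhile (Le $15 $5) (entry ;; APut 6 ($6 :+ $15) $20 ;; ASet 15 ($15 :+ #1)).

(** A node is named by the first of [l + 1] consecutive indices. Array 6 holds its table at all of
    them; arrays 7 to 9 are used at the first only. *)
Definition make_node (kind : nat) (left right : expr) (entry : acmd) : acmd :=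
  (APut 7 $6 #kind ;; APut 8 $6 left ;; APut 9 $6 right) ;;
  fill_table entry ;;
  (ASet 11 $6 ;; ASet 6 ($6 :+ $5 :+ #1)).

Definition leaf_entry : acmd := AIf (Le $15 $17) (ASet 20 #0) (ASet 20 #1).

Definition par_entry : acmd :=
  AGet 20 6 ($13 :+ $15) ;; AGet 21 6 ($14 :+ $15) ;; ASet 20 ($20 :+ $21).

Definition ser_start : acmd :=
  AGet 20 6 $13 ;; AGet 21 6 ($14 :+ $15) ;; ASet 20 ($20 :+ $21) ;; ASet 16 #1.

Definition ser_body : acmd :=
  AGet 21 6 ($13 :+ $16) ;; AGet 22 6 ($14 :+ ($15 :- $16)) ;;
  ASet 21 ($21 :+ $22) ;; AIf (Le $21 $20) (ASet 20 $21) ASkip ;;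
  ASet 16 ($16 :+ #1).

Definition ser_entry : acmd := ser_start ;; AWhile (Le $16 $15) ser_body.

Definition ser_entry_cost : nat :=
  acost ser_start + (acost ser_body + test_cost (Le $16 $15)).+1.

(** The loop body runs [l + 1] times and the test once more; the factor 2 comes from
    [l + 2 <= 2 * (l + 1)]. *)
Definition node_cost (kind : nat) (left right : expr) (c : nat) : nat :=
  acost (APut 7 $6 #kind ;; APut 8 $6 left ;; APut 9 $6 right) + acost (ASet 15 #0) +
  acost (ASet 11 $6 ;; ASet 6 ($6 :+ $5 :+ #1)) +
  2 * (c + acost (APut 6 ($6 :+ $15) $20 ;; ASet 15 ($15 :+ #1)) + test_cost (Le $15 $5)).+1.

Definition make_leaf_cost : nat := node_cost 0 $8 #0 (acost leaf_entry).
Definition make_ser_cost : nat := node_cost 1 $13 $14 ser_entry_cost.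
Definition make_par_cost : nat := node_cost 2 $13 $14 (acost par_entry).

(** In a leaf the field of the left child holds the number of the edge. *)
Definition make_leaf : acmd := make_node 0 $8 #0 leaf_entry.
Definition make_ser : acmd := make_node 1 $13 $14 ser_entry.
Definition make_par : acmd := make_node 2 $13 $14 par_entry.

Definition same (X : seq nat) (r r' : nat -> nat) : Prop :=
  forall x, x \notin X -> r' x = r x.

Ltac vcgen := rewrite /=; repeat match goal with
  | |- and3 _ _ _ => split | |- and4 _ _ _ _ => split | |- _ /\ _ => split end;
  rewrite ?ltn0 //=.

Section Nodes.
Variables (B l : nat).

(** Entries are computed while the new table is being written, so only the part of array 6 below
    [r 6] is assumed to be unchanged. *)
Definition entry_spec (entry : acmd) (t : nat) (r : nat -> nat) (a : nat -> nat -> nat)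
    (F : nat -> nat) : Prop :=
  forall r1 a1, same [:: 15; 16; 20; 21; 22] r r1 ->
    (forall i, i < r 6 -> a1 6 i = a 6 i) -> r1 15 <= l ->
    awp B entry t r1 a1
      (fun r2 a2 => [/\ a2 = a1, r2 20 = F (r1 15) & same [:: 16; 20; 21; 22] r1 r2]).

Definition node_built (kind left right : nat) (F : nat -> nat)
    (r : nat -> nat) (a : nat -> nat -> nat) (r' : nat -> nat) (a' : nat -> nat -> nat) :=
  [/\ r' 6 = r 6 + l + 1, r' 11 = r 6,
      same [:: 6; 11; 15; 16; 20; 21; 22] r r',
      forall k i, k \notin [:: 6; 7; 8; 9] \/ i < r 6 -> a' k i = a k i &
      [/\ a' 7 (r 6) = kind, a' 8 (r 6) = left, a' 9 (r 6) = right &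
          forall j, j <= l -> a' 6 (r 6 + j) = F j]].

Lemma fill_table_spec entry t r a F :
  r 5 = l -> entry_spec entry t r a F ->
  awp B (fill_table entry)
    (acost (ASet 15 #0) +
     (t + acost (APut 6 ($6 :+ $15) $20 ;; ASet 15 ($15 :+ #1)) + test_cost (Le $15 $5)).+1 * l.+2) r a
    (fun r' a' => [/\ same [:: 15; 16; 20; 21; 22] r r',
       forall k i, k <> 6 \/ i < r 6 -> a' k i = a k i &
       forall j, j <= l -> a' 6 (r 6 + j) = F j]).
Proof.
move=> r5 hent; apply: awp_straight_seq; vcgen.
apply: (awp_while (I := fun N r1 a1 =>
  [/\ same [:: 15; 16; 20; 21; 22] r r1, r1 15 + N = l.+1,
      forall k i, k <> 6 \/ i < r 6 -> a1 k i = a k i &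
      forall j, j < r1 15 -> a1 6 (r 6 + j) = F j])).
- by [].
- move=> N r1 a1 [h1 h2 h3 h4]; rewrite /= (h1 5) // r5 => h5.
  apply: awp_seq; apply: awp_weaken (leqnn _) _.
    by apply: hent => // i hi; apply: h3; right.
  move=> r2 a2 [-> h6 h7]; apply: awp_straight; vcgen.
  exists N.-1; first lia.
  split; rewrite /=.
  + by move=> x hx; rewrite upd_diff ?(h7 x) ?(h1 x) //; move: hx; rewrite !inE; lia.
  + by rewrite (h7 15) //; lia.
  + move=> k i hk; rewrite /aupd; case: (PeanoNat.Nat.eqb_spec k 6) => [ek|_]; last exact: h3.
    subst k; case: hk => // hi; rewrite upd_diff; first by apply: h3; right.
    by rewrite (h7 6) // (h7 15) // (h1 6) //; lia.
  + move=> j; rewrite (h7 6) // (h7 15) // (h1 6) // h6 updE => hj.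
    by case: eqP => [e|ne]; [congr F; lia | apply: h4; lia].
- move=> N r1 a1 [h1 h2 h3 h4]; rewrite /= (h1 5) // r5 -ltnNge => h5; split=> // j hj.
  by apply: h4; lia.
split=> //=.
by move=> x hx; rewrite upd_diff //; move: hx; rewrite !inE; lia.
Qed.

Lemma make_node_spec kind left right entry t r a F c :
  r 5 = l -> nsafe r left -> nsafe r right ->
  entry_spec entry t r a F -> t <= c ->
  awp B (make_node kind left right entry)
    (acost (APut 7 $6 #kind ;; APut 8 $6 left ;; APut 9 $6 right) +
     (acost (ASet 15 #0) +
      (c + acost (APut 6 ($6 :+ $15) $20 ;; ASet 15 ($15 :+ #1)) + test_cost (Le $15 $5)).+1 * l.+2 +
     acost (ASet 11 $6 ;; ASet 6 ($6 :+ $5 :+ #1)))) r a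
    (node_built kind (neval r left) (neval r right) F r a).
Proof.
move=> r5 sl sr hent tc; apply: awp_straight_seq; vcgen.
apply: awp_seq; set a1 := aupd _ _ _ _.
have hent1 : entry_spec entry t r a1 F.
  by move=> r1 a2 h1 h2 h3; apply: hent => // i hi; rewrite h2.
apply: awp_weaken (fill_table_spec r5 hent1) _ _.
  by rewrite leq_add2l leq_mul2r; apply/orP; right; rewrite ltnS !leq_add2r.
move=> r2 a2 [h1 h2 h3]; apply: awp_straight; vcgen; split=> /=.
- by rewrite (h1 6) // (h1 5) // r5.
- by rewrite (h1 6).
- by move=> x hx; rewrite !upd_diff ?(h1 x) //; move: hx; rewrite !inE; lia.
- move=> k i hk; rewrite h2; last by case: hk; [rewrite !inE; lia | right].
  rewrite /a1 /aupd; case: hk => hk.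
    have -> : Nat.eqb k 9 = false by move: hk; rewrite !inE; lia.
    have -> : Nat.eqb k 8 = false by move: hk; rewrite !inE; lia.
    by have -> : Nat.eqb k 7 = false by move: hk; rewrite !inE; lia.
  by do 3!case: ifP => _; rewrite ?upd_diff //; lia.
- by split=> //; rewrite ?h2 /a1 /= ?upd_same //; left.
Qed.

Lemma leaf_entry_spec r a tau :
  r 17 = tau -> entry_spec leaf_entry (acost leaf_entry) r a (fun j => tau < j).
Proof.
move=> r17 r1 a1 h1 h2 h3; apply: awp_straight; vcgen.
rewrite (h1 17) // r17; case: leqP => h; vcgen.
- by move=> x; rewrite !inE => hx; rewrite upd_diff //; lia.
- by move=> x; rewrite !inE => hx; rewrite upd_diff //; lia.
Qed.

Lemma par_entry_spec r a f g :
  r 13 + l < r 6 -> r 14 + l < r 6 ->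
  (forall j, j <= l -> a 6 (r 13 + j) = f j) -> (forall j, j <= l -> a 6 (r 14 + j) = g j) ->
  entry_spec par_entry (acost par_entry) r a (fun j => f j + g j).
Proof.
move=> hp hq hf hg r1 a1 h1 h2 h3; apply: awp_straight; vcgen.
  by rewrite (h1 13) // (h1 14) // !h2 ?hf ?hg //; lia.
by move=> x; rewrite !inE => hx; rewrite !upd_diff //; lia.
Qed.

Lemma ser_entry_spec r a f g :
  r 13 + l < r 6 -> r 14 + l < r 6 ->
  (forall j, j <= l -> a 6 (r 13 + j) = f j) -> (forall j, j <= l -> a 6 (r 14 + j) = g j) ->
  entry_spec ser_entry (ser_entry_cost * l.+1) r a (fun j => minsum f g j j).
Proof.
pose c0 := acost ser_start.
pose c1 := (acost ser_body + test_cost (Le $16 $15)).+1.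
move=> hp hq hf hg r1 a1 h1 h2 h3; rewrite -[ser_entry_cost]/(c0 + c1).
have tf i : i <= l -> a1 6 (r1 13 + i) = f i by move=> hi; rewrite (h1 13) // h2 ?hf //; lia.
have tg i : i <= l -> a1 6 (r1 14 + i) = g i by move=> hi; rewrite (h1 14) // h2 ?hg //; lia.
apply: (@awp_weaken _ _ (c0 + c1 * (r1 15).+1) _ _ _ (fun r2 a2 =>
  [/\ a2 = a1, r2 20 = minsum f g (r1 15) (r1 15) & same [:: 16; 20; 21; 22] r1 r2])) => //.
  apply: awp_straight_seq; vcgen.
  apply: (awp_while (I := fun N r2 a2 => [/\ a2 = a1, r2 16 + N = (r1 15).+1, 0 < r2 16,
    r2 20 = minsum f g (r1 15) (r2 16).-1 & same [:: 16; 20; 21; 22] r1 r2])) => //.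
  - move=> N r2 a2 [-> h4 h5 h6 h7]; rewrite /= (h7 15) // => h8.
    apply: awp_straight; vcgen; rewrite ?(h7 13) ?(h7 14) ?(h7 15) //= tf ?tg; try lia.
    have st r3 : (forall x, x \notin [:: 16; 20; 21; 22] -> r3 x = r1 x) ->
       r3 16 = r2 16 + 1 -> r3 20 = minsum f g (r1 15) (r2 16) ->
       exists2 N' : nat, N' < N & [/\ a1 = a1, r3 16 + N' = (r1 15).+1, 0 < r3 16,
        r3 20 = minsum f g (r1 15) (r3 16).-1 & same [:: 16; 20; 21; 22] r1 r3].
      by move=> q1 q2 q3; exists N.-1; [lia | split; rewrite ?q2 ?addn1 //=; lia].
    have e16 : r2 16 = (r2 16).-1.+1 by lia.
    case: ifP => hm; vcgen; apply: st => //=.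
    + by move=> x hx; rewrite !upd_diff ?(h7 x) //; move: hx; rewrite !inE; lia.
    + by rewrite [in RHS]e16 /= -e16 -h6; lia.
    + by move=> x hx; rewrite !upd_diff ?(h7 x) //; move: hx; rewrite !inE; lia.
    + by rewrite [in RHS]e16 /= -e16 -h6; lia.
  - move=> N r2 a2 [-> h4 h5 h6 h7]; rewrite /= (h7 15) // => h8; split=> //.
    by rewrite h6; congr minsum; lia.
  split=> //=; first by rewrite -[r1 13]addn0 tf // tg.
  by move=> x; rewrite !inE => hx; rewrite !upd_diff //; lia.
rewrite mulnDl; apply: leq_add; first exact: leq_pmulr.
by rewrite leq_mul2l; apply/orP; right.
Qed.

Variables (E : finType) (code : E -> nat) (tau : E -> nat).

(** All indices of the tree lie below [H], the first free one; nodes are never modified, so later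
    allocations leave the tree intact. *)
Fixpoint tree_at (H : nat) (a : nat -> nat -> nat) (p : nat) (T : tree E) : Prop :=
  [/\ p + l < H, forall j, j <= l -> a 6 (p + j) = copt tau T j &
      match T with
      | Leaf e => a 7 p = 0 /\ a 8 p = code e
      | Ser T1 T2 => [/\ a 7 p = 1, tree_at H a (a 8 p) T1 & tree_at H a (a 9 p) T2]
      | Par T1 T2 => [/\ a 7 p = 2, tree_at H a (a 8 p) T1 & tree_at H a (a 9 p) T2]
      end].

Lemma tree_at_frame H H' a a' p T :
  (forall k i, k \in [:: 6; 7; 8; 9] -> i < H -> a' k i = a k i) -> H <= H' ->
  tree_at H a p T -> tree_at H' a' p T.
Proof.
move=> ha hH; elim: T p => [e|T1 h1 T2 h2|T1 h1 T2 h2] p /= [hp ht hk].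
all: have hp' : p < H by lia.
all: split; [lia | by move=> j hj; rewrite ha ?ht //; lia | rewrite !ha //].
all: by case: hk => ? ? ?; split=> //; [exact: h1 | exact: h2].
Qed.

Lemma tree_at_bound H a p T : tree_at H a p T -> p + l < H.
Proof. by case: T => [e|T1 T2|T1 T2] []. Qed.

Lemma tree_at_table H a p T j : tree_at H a p T -> j <= l -> a 6 (p + j) = copt tau T j.
Proof. by case: T => [e|T1 T2|T1 T2] [_ h _]; exact: h. Qed.

Definition new_node (T : tree E) r (a : nat -> nat -> nat) r' a' : Prop :=
  [/\ r' 6 = r 6 + l + 1, r' 11 = r 6,
      same [:: 6; 11; 15; 16; 20; 21; 22] r r',
      forall k i, k \notin [:: 6; 7; 8; 9] \/ i < r 6 -> a' k i = a k i &
      tree_at (r' 6) a' (r' 11) T].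

Lemma linear_bound a b c d : a + (b + c.+1 * l.+2 + d) <= (a + b + d + 2 * c.+1) * l.+1.
Proof. by nia. Qed.

Lemma quadratic_bound a b c d1 d2 d :
  a + (b + (c * l.+1 + d1 + d2).+1 * l.+2 + d) <=
  (a + b + d + 2 * (c + d1 + d2).+1) * (l.+1 * l.+1).
Proof.
have h : (c * l.+1 + d1 + d2).+1 <= (c + d1 + d2).+1 * l.+1 by nia.
by have := leq_mul h (_ : l.+2 <= 2 * l.+1); nia.
Qed.

Lemma make_leaf_spec r a e :
  r 5 = l -> r 8 = code e -> r 17 = tau e ->
  awp B make_leaf (make_leaf_cost * l.+1) r a (new_node (Leaf e) r a).
Proof.
move=> r5 r8 r17.
have hent := leaf_entry_spec (a := a) r17.
have h := make_node_spec 0 (left := $8) (right := #0) r5 isT isT hent (leqnn _).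
apply: awp_weaken h (linear_bound _ _ _ _) _.
move=> r' a' [e6 e11 sr sa [k1 k2 k3 k4]]; split=> //.
by rewrite /= e6 e11; split; [lia | exact: k4 | rewrite k1 k2 -r8].
Qed.

Lemma make_par_spec r a T1 T2 :
  r 5 = l -> tree_at (r 6) a (r 13) T1 -> tree_at (r 6) a (r 14) T2 ->
  awp B make_par (make_par_cost * l.+1) r a (new_node (Par T1 T2) r a).
Proof.
move=> r5 R1 R2.
have hent := par_entry_spec (tree_at_bound R1) (tree_at_bound R2)
  (fun j => tree_at_table R1 (j := j)) (fun j => tree_at_table R2 (j := j)).
have h := make_node_spec 2 (left := $13) (right := $14) r5 isT isT hent (leqnn _).
apply: awp_weaken h (linear_bound _ _ _ _) _.
move=> r' a' [e6 e11 sr sa [k1 k2 k3 k4]]; split=> //.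
rewrite /= e6 e11; split; [lia | exact: k4 | rewrite k1 k2 k3].
by split=> //; [apply: tree_at_frame R1 | apply: tree_at_frame R2];
  (try lia); move=> k i _ hi; apply: sa; right.
Qed.

Lemma make_ser_spec r a T1 T2 :
  r 5 = l -> tree_at (r 6) a (r 13) T1 -> tree_at (r 6) a (r 14) T2 ->
  awp B make_ser (make_ser_cost * (l.+1 * l.+1)) r a (new_node (Ser T1 T2) r a).
Proof.
move=> r5 R1 R2.
have hent := ser_entry_spec (tree_at_bound R1) (tree_at_bound R2)
  (fun j => tree_at_table R1 (j := j)) (fun j => tree_at_table R2 (j := j)).
have h := make_node_spec 1 (left := $13) (right := $14) r5 isT isT hent (leqnn _).
apply: awp_weaken h (quadratic_bound _ _ _ _ _ _) _.
move=> r' a' [e6 e11 sr sa [k1 k2 k3 k4]]; split=> //.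
rewrite /= e6 e11; split; [lia | exact: k4 | rewrite k1 k2 k3].
by split=> //; [apply: tree_at_frame R1 | apply: tree_at_frame R2];
  (try lia); move=> k i _ hi; apply: sa; right.
Qed.

End Nodes.

(** * The graph in memory and the insertion of an edge *)

Definition locate_edge : acmd :=
  AGet 18 3 $9 ;; ASet 18 ($18 :+ $10) ;; AGet 19 3 $10 ;; ASet 19 ($19 :+ $9) ;;
  AGet 13 4 $18.

Definition count_edge : acmd :=
  AGet 20 0 $9 ;; APut 0 $9 ($20 :+ #1) ;; AGet 20 1 $9 ;; APut 1 $9 ($20 :+ $10) ;;
  AGet 20 0 $10 ;; APut 0 $10 ($20 :+ #1) ;; AGet 20 1 $10 ;; APut 1 $10 ($20 :+ $9).

Definition store_edge : acmd :=
  APut 4 $18 $11 ;; APut 4 $19 $11 ;; APut 2 $9 $10 ;; APut 2 $10 $9.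

Definition insert_edge : acmd :=
  locate_edge ;; AIf (Eq $13 #0) count_edge (ASet 14 $11 ;; make_par) ;; store_edge.

Definition insert_cost : nat :=
  acost locate_edge +
  (test_cost (Eq $13 #0) + (acost count_edge + acost (ASet 14 $11) + make_par_cost)).+1 +
  acost store_edge.

Section GraphMemory.
Variables (B l : nat) (G : ttgraph) (tau : 'I_(ne G) -> nat).
Notation V := 'I_(nv G).
Notation E := 'I_(ne G).
Notation n := (nv G).
Notation tree_atG := (tree_at l (@nat_of_ord (ne G)) tau).
Implicit Types (g : V -> V -> option (tree E)) (u v w x y : V).

(** Degree and sum of the neighbours are the instances with weights [degF] and [sumF], so both are
    updated by the same argument. *)
Definition wsum (F : V -> nat) (f : V -> bool) : nat := \sum_y f y * F y.

Lemma eq_wsum F f f' : f =1 f' -> wsum F f = wsum F f'.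
Proof. by move=> e; apply: eq_bigr => y _; rewrite e. Qed.

Lemma wsum_add F f f' w :
  (forall y, y != w -> f' y = f y) -> ~~ f w -> f' w -> wsum F f' = wsum F f + F w.
Proof.
move=> e fw f'w; rewrite /wsum (bigD1 w) //= [in RHS](bigD1 w) //= f'w (negbTE fw).
rewrite mul1n mul0n add0n addnC; congr (_ + _).
by apply: eq_bigr => y yw; rewrite e.
Qed.

Definition cell u v : nat := u * n + v.

Lemma cell_eq u v u' v' : (cell u v == cell u' v') = (u == u') && (v == v').
Proof.
apply/eqP/andP => [e|[/eqP-> /eqP->]//].
have n0 : 0 < n by apply: leq_ltn_trans (ltn_ord u).
have := congr1 (divn^~ n) e; have := congr1 (modn^~ n) e.
rewrite /cell !modnMDl !divnMDl // !divn_small // !addn0 !modn_small // => ev eu.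
by split; apply/eqP/val_inj.
Qed.

Definition degF : V -> nat := fun=> 1.
Definition sumF : V -> nat := fun y => y.

Record graph_mem (r : nat -> nat) (a : nat -> nat -> nat) g : Prop := GraphMem {
  gm_l : r 5 = l;
  gm_H : 0 < r 6;
  gm_row : forall u, a 3 u = u * n;
  gm_adj : forall u v, if g u v is Some T
    then 0 < a 4 (cell u v) /\ tree_atG (r 6) a (a 4 (cell u v)) T else a 4 (cell u v) = 0;
  gm_deg : forall u, a 0 u = wsum degF (fun v => isSome (g u v));
  gm_sum : forall u, a 1 u = wsum sumF (fun v => isSome (g u v)) }.

(** For an isolated vertex the recorded neighbour may be stale. *)
Definition has_neighbour (a : nat -> nat -> nat) g x : Prop :=
  forall y, isSome (g x y) -> exists2 z : V, a 2 x = z & isSome (g x z).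

(** The assumption on recorded neighbours exempts [u] and [w], since their entries may still name
    the vertex just detached; storing the edge makes them name each other. *)
Lemma insert_edge_spec r a i g u w T :
  graph_mem r a g -> tree_graph tau i g -> u != w -> r 9 = u -> r 10 = w -> 0 < r 11 ->
  tree_atG (r 6) a (r 11) T ->
  (forall x, x != u -> x != w -> has_neighbour a g x) ->
  awp B insert_edge (insert_cost * l.+1) r a (fun r' a' =>
    [/\ graph_mem r' a' (insert g u w T), forall x, has_neighbour a' (insert g u w T) x,
        same [:: 6; 11; 13; 14; 15; 16; 18; 19; 20; 21; 22] r r' &
        forall k i, k \notin [:: 0; 1; 2; 4; 6; 7; 8; 9] -> a' k i = a k i]).
Proof.
pose c := make_par_cost.
have hc := @make_par_spec B l _ (@nat_of_ord (ne G)) tau; rewrite -/c in hc.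
pose c1 := acost locate_edge.
pose c2 := acost count_edge + acost (ASet 14 $11) + c.
pose c3 := acost store_edge.
rewrite -[insert_cost]/(c1 + (test_cost (Eq $13 #0) + c2).+1 + c3).
clearbody c; move=> gm tg uw r9 r10 r11 RT nb.
have [symg irrg _ _ _ _] := tg.
case: gm => rl rH hrow hadj hdeg hsum.
pose T' := if g u w is Some T0 then Par T0 T else T.
apply: (@awp_weaken _ _ (c1 + ((test_cost (Eq $13 #0) + c2 * l.+1).+1 + c3)) _ _ _ _ _); last 2 first.
- by rewrite -!/(acost _); nia.
- by move=> r' a'; exact.
apply: awp_straight_seq; vcgen; rewrite r9 r10 !hrow -!/(cell _ _) /=.
set r0 := upd _ 13 _.
apply: awp_seq.
apply: (awp_weaken (Q := fun r1 a1 =>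
  [/\ same [:: 6; 11; 14; 15; 16; 20; 21; 22] r0 r1, 0 < r1 11, tree_atG (r1 6) a1 (r1 11) T', 
      [/\ r 6 <= r1 6, forall k i, k \notin [:: 0; 1; 6; 7; 8; 9] -> a1 k i = a k i &
      forall k i, k \in [:: 6; 7; 8; 9] -> i < r 6 -> a1 k i = a k i] &
      forall x, a1 0 x = wsum degF (fun v => isSome (insert g u w T x v)) /\
                a1 1 x = wsum sumF (fun v => isSome (insert g u w T x v))])
   _ (leqnn _)); last first.
  move=> r1 a1 [s1 p1 R1 [H1 f1 f2] d1].
  have e18 : r1 18 = cell u w by rewrite s1.
  have e19 : r1 19 = cell w u by rewrite s1.
  have e9 : r1 9 = u by rewrite s1.
  have e10 : r1 10 = w by rewrite s1.
  apply: awp_straight; vcgen; rewrite ?e18 ?e19 ?e9 ?e10.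
  + split=> /=.
    * by rewrite s1.
    * exact: leq_trans H1.
    * by move=> x; rewrite f1.
    * move=> x y; rewrite /insert !updE !cell_eq.
      case: ifP => h /=.
        have -> : (if (x == w) && (y == u) then r1 11 else if (x == u) && (y == w) then r1 11 else a1 4 (cell x y)) = r1 11.
          by case: ifP => // hB; move: h; rewrite hB orbF => ->.
        split=> //; apply: tree_at_frame R1 => // k j hk hj.
        by rewrite /aupd; move: hk; rewrite !inE => /or4P[] /eqP->.
      move/negbT: h; rewrite negb_or => /andP[/negbTE h1 /negbTE h2].
      rewrite h2 h1 f1 //; have := hadj x y; case: (g x y) => // T1 [q1 q2]; split=> //.
      apply: tree_at_frame q2 => // k j hk hj.
      by rewrite -f2 // /aupd; move: hk; rewrite !inE => /or4P[] /eqP->.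
    * by move=> x; have [] := d1 x.
    * by move=> x; have [] := d1 x.
  + move=> x y /=; rewrite !updE !(inj_eq val_inj).
    have [->|xw] := eqVneq x w.
      by exists u => //; rewrite /insert !eqxx orbT.
    have [->|xu] := eqVneq x u.
      by exists w => //; rewrite /insert !eqxx.
    rewrite f1 // => hxy; have [|z e gz] := nb x xu xw y.
      by move: hxy; rewrite /insert (negbTE xu) (negbTE xw).
    by exists z => //; rewrite /insert (negbTE xu) (negbTE xw).
  + move=> x; rewrite !inE => hx; rewrite s1; last by rewrite !inE; lia.
    by rewrite /r0 !upd_diff //; lia.
  + move=> k j hk; rewrite -(f1 k j); last by move: hk; rewrite !inE; lia.
    rewrite /aupd; have -> : Nat.eqb k 4 = false by move: hk; rewrite !inE; lia.
    by have -> : Nat.eqb k 2 = false by move: hk; rewrite !inE; lia.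
apply: awp_if => //=.
- move=> e0; apply: (@awp_weaken _ _ (acost count_edge)); last 2 first.
    by rewrite /c2; nia.
    by move=> r' a'; exact.
  have guw : g u w = None.
    by have := hadj u w; case: (g u w) => // T0 []; have -> : a 4 (cell u w) = 0 by exact/eqP.
  have gwu : g w u = None by rewrite symg.
  apply: awp_straight; vcgen.
  have -> : r0 9 = u by []. 
  have -> : r0 10 = w by [].
  split.
  + by move=> x; rewrite !inE => hx; rewrite !upd_diff //; lia.
  + by [].
  + rewrite /T' guw; apply: tree_at_frame RT => // k j hk hj.
    by move: hk; rewrite !inE => /or4P[] /eqP->.
  + split=> // k j hk; rewrite !aupd_diff //; move: hk; rewrite !inE; lia.
  + move=> x; split; rewrite !updE !(inj_eq val_inj).
      rewrite [w == u]eq_sym (negbTE uw); have [->|xw] := eqVneq x w.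
        rewrite hdeg -[1]/(degF u); apply/esym/wsum_add; rewrite ?gwu //.
          by move=> y yu; rewrite /insert eqxx [w == u]eq_sym (negbTE uw) (negbTE yu).
        by rewrite /insert !eqxx orbT.
      have [->|xu] := eqVneq x u.
        rewrite hdeg -[1]/(degF w); apply/esym/wsum_add; rewrite ?guw //.
          by move=> y yw; rewrite /insert eqxx (negbTE uw) (negbTE yw).
        by rewrite /insert !eqxx.
      by rewrite hdeg; apply: eq_wsum => y; rewrite /insert (negbTE xu) (negbTE xw).
    rewrite [w == u]eq_sym (negbTE uw); have [->|xw] := eqVneq x w.
      rewrite hsum -[X in _ + X]/(sumF u); apply/esym/wsum_add; rewrite ?gwu //.
        by move=> y yu; rewrite /insert eqxx [w == u]eq_sym (negbTE uw) (negbTE yu).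
      by rewrite /insert !eqxx orbT.
    have [->|xu] := eqVneq x u.
      rewrite hsum -[X in _ + X]/(sumF w); apply/esym/wsum_add; rewrite ?guw //.
        by move=> y yw; rewrite /insert eqxx (negbTE uw) (negbTE yw).
      by rewrite /insert !eqxx.
    by rewrite hsum; apply: eq_wsum => y; rewrite /insert (negbTE xu) (negbTE xw).
- move=> e0; have {}e0 : a 4 (cell u w) != 0 by exact: e0.
  apply: (@awp_weaken _ _ (acost (ASet 14 $11) + c * l.+1)); last 2 first.
    by rewrite /c2; nia.
    by move=> r' a'; exact.
  have [T0 guw] : exists T0, g u w = Some T0.
    by have := hadj u w; case: (g u w) => [T0|e]; [exists T0 | rewrite e in e0].
  have [p0 R0] : 0 < a 4 (cell u w) /\ tree_atG (r 6) a (a 4 (cell u w)) T0.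
    by have := hadj u w; rewrite guw.
  apply: awp_straight_seq; vcgen.
  apply: awp_weaken (hc _ _ T0 T _ _ _) (leqnn _) _ => //=.
  move=> r' a' [q1 q2 q3 q4 q5] /=; split.
  + move=> x; rewrite !inE => hx; rewrite q3; last by rewrite !inE; lia.
    by rewrite upd_diff //; lia.
  + by rewrite q2.
  + by rewrite /T' guw.
  + have e6 : r' 6 = r 6 + l + 1 := q1.
    split; first by rewrite e6 -addnA leq_addr.
      by move=> k j hk; apply: q4; left; move: hk; rewrite !inE; lia.
    by move=> k j _ hj; apply: q4; right.
  + move=> x; rewrite !q4; try by left.
    rewrite hdeg hsum; split; apply: eq_wsum => y; rewrite /insert; case: ifP => // /orP[]/andP[/eqP-> /eqP->];
      by rewrite ?guw // symg guw.
Qed.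

End GraphMemory.

(** * Initialising the vertices and reading the edges *)

Definition init_vertex : acmd :=
  APut 3 $8 $9 ;; APut 5 $8 $8 ;; ASet 9 ($9 :+ $1) ;; ASet 8 ($8 :+ #1).

(** Every vertex starts on the stack, as any of them may have degree two. Node numbers start at 1
    because 0 in the adjacency matrix means that there is no edge. *)
Definition init_vertices : acmd :=
  (ASet 8 #0 ;; ASet 9 #0) ;; AWhile (Le ($8 :+ #1) $1) init_vertex ;;
  (ASet 7 $1 ;; ASet 6 #1).

Definition init_cost : nat :=
  acost (ASet 8 #0 ;; ASet 9 #0) + (acost init_vertex + test_cost (Le ($8 :+ #1) $1)).+1 +
  acost (ASet 7 $1 ;; ASet 6 #1).

Definition fetch_edge : acmd :=
  AGet 9 16 $12 ;; AGet 10 16 ($12 :+ #1) ;; AGet 17 16 ($12 :+ #2) ;; ASet 12 ($12 :+ #3).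

Definition read_edges : acmd :=
  (ASet 8 #0 ;; ASet 12 #5) ;;
  AWhile (Le ($8 :+ #1) $2) (fetch_edge ;; make_leaf ;; insert_edge ;; ASet 8 ($8 :+ #1)).

Definition read_cost : nat :=
  acost (ASet 8 #0 ;; ASet 12 #5) +
  (acost fetch_edge + make_leaf_cost + insert_cost + acost (ASet 8 ($8 :+ #1)) +
   test_cost (Le ($8 :+ #1) $2)).+1.

Section Phases.
Variables (B l : nat) (G : ttgraph) (tau : 'I_(ne G) -> nat).
Notation V := 'I_(nv G).
Notation E := 'I_(ne G).
Notation n := (nv G).
Notation m := (ne G).
Notation tree_atG := (tree_at l (@nat_of_ord (ne G)) tau).
Notation graph_memG := (graph_mem l tau).
Implicit Types (g : V -> V -> option (tree E)) (u v w x y : V).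

Lemma init_vertices_spec r a : r 1 = n ->
  awp B init_vertices (init_cost * n.+1) r a (fun r' a' =>
    [/\ forall u, a' 3 u = u * n /\ a' 5 u = u, r' 6 = 1, r' 7 = n,
        same [:: 6; 7; 8; 9] r r' &
        forall k i, k \notin [:: 3; 5] -> a' k i = a k i]).
Proof.
pose c0 := acost (ASet 8 #0 ;; ASet 9 #0).
pose c1 := (acost init_vertex + test_cost (Le ($8 :+ #1) $1)).+1.
pose c2 := acost (ASet 7 $1 ;; ASet 6 #1).
rewrite -[init_cost]/(c0 + c1 + c2) => r1.
apply: (@awp_weaken _ _ (c0 + (c1 * n.+1 + c2)) _ _ _ _ _ _ _ (fun _ _ h => h)); last first.
  by clearbody c0 c1 c2; nia.
apply: awp_straight_seq; vcgen; apply: awp_seq.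
apply: (awp_while (I := fun N r' a' =>
    [/\ r' 8 + N = n, r' 9 = r' 8 * n, forall u, u < r' 8 -> a' 3 u = u * n /\ a' 5 u = u,
        same [:: 8; 9] r r' &
        forall k i, k \notin [:: 3; 5] -> a' k i = a k i])) => //.
- move=> N r' a' [h1 h2 h3 h4 h5]; rewrite /= (h4 1) // r1 => h6.
  apply: awp_straight; vcgen; exists N.-1; first lia.
  split=> /=.
  + by lia.
  + by rewrite (h4 1) // r1 h2 mulnDl mul1n.
  + move=> u hu; rewrite !updE; case: eqP => [->//|ne].
    by apply: h3; lia.
  + by move=> x hx; rewrite !upd_diff ?h4 //; move: hx; rewrite !inE; lia.
  + by move=> k i hk; rewrite !aupd_diff ?h5 //; move: hk; rewrite !inE; lia.
- move=> N r' a' [h1 h2 h3 h4 h5]; rewrite /= (h4 1) // r1 => h6.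
  apply: awp_straight; vcgen; split=> //=.
  + by move=> u; apply: h3; have := ltn_ord u; lia.
  + by rewrite h4.
  + by move=> x hx; rewrite !upd_diff ?h4 //; move: hx; rewrite !inE; lia.
split=> //=.
by move=> x hx; rewrite !upd_diff //; move: hx; rewrite !inE; lia.
Qed.

Lemma graph_mem_frame r a g r' a' :
  graph_memG r a g -> r' 5 = r 5 -> r 6 <= r' 6 ->
  (forall k i, k \notin [:: 6; 7; 8; 9] \/ i < r 6 -> a' k i = a k i) -> graph_memG r' a' g.
Proof.
case=> h1 h2 h3 h4 h5 h6 e5 le6 ha.
split; rewrite ?e5 //.
- exact: leq_trans le6.
- by move=> u; rewrite ha //; left.
- move=> u v; rewrite ha; last by left.
  have := h4 u v; case: (g u v) => // T [p0 R0]; split=> //.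
  by apply: tree_at_frame R0 => // k i _ hi; apply: ha; right.
- by move=> u; rewrite ha //; left.
- by move=> u; rewrite ha //; left.
Qed.

Definition edges_upto (i : nat) : {set V * V} :=
  [set p | [exists e : E, (e < i) && joins e p.1 p.2]].

Lemma edges_upto_full : edges_upto m = image_edges (@id V).
Proof.
apply/setP=> -[x y]; rewrite inE /=; apply/existsP/image_edgesP.
  by case=> e /andP[_ j]; exists e, x, y.
by case=> e [u [v [j -> ->]]]; exists e; rewrite ltn_ord.
Qed.

Lemma edges_uptoS (e : E) : edges_upto e.+1 = edges_upto e :|: uedge (ends e).1 (ends e).2.
Proof.
apply/setP=> -[x y]; rewrite in_setU in_uedge !inE /=; apply/existsP/orP.
  case=> e'; rewrite ltnS leq_eqVlt => /andP[/predU1P[/val_inj->|lt] j].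
    right; have [[-> ->]|[-> ->]] := joins_inj j (joins_ends e); by rewrite !eqxx ?orbT.
  by left; apply/existsP; exists e'; rewrite lt.
case=> [/existsP[e' /andP[lt j]]|h].
  by exists e'; rewrite j ltnW //.
exists e; rewrite ltnSn /=.
by case/orP: h => /andP[/eqP-> /eqP->]; rewrite ?joins_ends // joinsC joins_ends.
Qed.

Hypothesis loopless : forall e : E, (ends e).1 != (ends e).2.

(** Array 16 is the input itself: five header cells, then three cells per edge. *)
Definition input_edges (a : nat -> nat -> nat) : Prop :=
  forall e : E, [/\ a 16 (5 + 3 * e) = (ends e).1, a 16 (5 + 3 * e + 1) = (ends e).2 &
                    a 16 (5 + 3 * e + 2) = tau e].

Definition frame_regs : seq nat := [:: 6; 8; 9; 10; 11; 12; 13; 14; 15; 16; 17; 18; 19; 20; 21; 22].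

Definition graph_read (i : nat) r a g : Prop :=
  [/\ graph_memG r a g, tree_graph tau i g, covers tau i g,
      forall x, has_neighbour a g x & edge_set g = edges_upto i].

Lemma read_edges_spec r a : 5 + 3 * m <= B -> r 2 = m ->
  input_edges a -> graph_memG r a (fun _ _ => None) ->
  awp B read_edges (read_cost * (m.+1 * l.+1)) r a (fun r' a' =>
    [/\ exists g, graph_read m r' a' g, same frame_regs r r' &
        forall k i, k \notin [:: 0; 1; 2; 4; 6; 7; 8; 9] -> a' k i = a k i]).
Proof.
pose cl := make_leaf_cost; pose ci := insert_cost.
have hl := @make_leaf_spec B l _ (@nat_of_ord m) tau; rewrite -/cl in hl.
have hi := @insert_edge_spec B l G tau; rewrite -/ci in hi.
pose c0 := acost (ASet 8 #0 ;; ASet 12 #5).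
pose cf := acost fetch_edge.
pose c8 := acost (ASet 8 ($8 :+ #1)).
pose ct := test_cost (Le ($8 :+ #1) $2).
rewrite -[read_cost]/(c0 + (cf + cl + ci + c8 + ct).+1).
clearbody cl ci => hB r2 inp gm0.
apply: (@awp_weaken _ _ (c0 + (cf + (cl * l.+1 + (ci * l.+1 + c8)) + ct).+1 * m.+1) _ _ _ _ _ _ _ (fun _ _ h => h)); last first.
  have h : (cf + (cl * l.+1 + (ci * l.+1 + c8)) + ct).+1 <= (cf + cl + ci + c8 + ct).+1 * l.+1.
    by clearbody c0 cf c8 ct; nia.
  have := leq_mul h (leqnn m.+1).
  by rewrite mulnDl -(mulnA _ l.+1) (mulnC l.+1); clearbody c0 cf c8 ct; nia.
apply: awp_straight_seq; vcgen.
apply: (awp_while (I := fun N r' a' =>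
    [/\ r' 8 + N = m, r' 12 = 5 + 3 * r' 8, exists g, graph_read (r' 8) r' a' g,
        same frame_regs r r' &
        forall k i, k \notin [:: 0; 1; 2; 4; 6; 7; 8; 9] -> a' k i = a k i])) => //.
- move=> N r' a' [h1 h2 [g [gm tg cg nb sg]] h4 h5]; rewrite /= (h4 2) // r2 => h6.
  have e_lt : r' 8 < m by lia.
  pose e := Ordinal e_lt.
  have [i1 i2 i3] := inp e.
  apply: awp_straight_seq; vcgen; try (rewrite h2; lia).
  rewrite !h5 // h2 i1 i2 i3.
  set r1 := upd _ 12 _.
  apply: awp_seq; apply: awp_weaken (hl r1 a' e _ _ _) (leqnn _) _ => //.
    by rewrite /r1 /= (gm_l gm).
  move=> r3 a3 [q1 q2 q3 q4 q5].
  have gm3 : graph_memG r3 a3 g.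
    apply: graph_mem_frame gm _ _ _; first by rewrite q3.
      by rewrite q1 -addnA leq_addr.
    exact: q4.
  apply: awp_seq.
  apply: awp_weaken (hi r3 a3 e g (ends e).1 (ends e).2 (Leaf e) _ _ _ _ _ _ _ _) (leqnn _) _ => //.
  + by rewrite q3.
  + by rewrite q3.
  + by rewrite q2 /r1 /=; apply: gm_H gm.
  + by move=> x _ _ y gxy; rewrite q4; [exact: nb gxy | left].
  move=> r4 a4 [w1 w2 w3 w4]; apply: awp_straight; vcgen.
  have e8 : r4 8 = r' 8 by rewrite w3 ?q3.
  exists N.-1; first lia.
  split=> /=.
  + by rewrite e8; lia.
  + by rewrite w3 // q3 // e8 /r1 /=; lia.
  + exists (insert g (ends e).1 (ends e).2 (Leaf e)); rewrite e8 addn1 -[r' 8]/(nat_of_ord e); split.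
    * by case: w1.
    * exact: tree_graph_insert_leaf.
    * exact: covers_insert.
    * by [].
    * by rewrite edge_set_insert sg edges_uptoS.
  + move=> x; rewrite !inE => hx; rewrite upd_diff; last lia.
    rewrite w3 ?q3; try (by rewrite !inE; lia).
    by rewrite /r1 !upd_diff ?h4 ?inE //; lia.
  + move=> k i hk; rewrite w4 // q4 ?h5 //; left.
    by move: hk; rewrite !inE; lia.
- move=> N r' a' [h1 h2 h3 h4 h5]; rewrite /= (h4 2) // r2 => h6; split=> //.
  have e8 : r' 8 = m by lia.
  by move: h3; rewrite e8.
split=> //=; last first.
  by move=> x; rewrite !inE => hx; rewrite !upd_diff //; lia.
exists (fun _ _ => None); split=> //.
- by case: gm0.
- by apply/setP=> -[x y]; rewrite !inE /=; apply/esym/existsP => -[].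
Qed.

End Phases.

(** * Eliminating vertices until none of degree two is left *)

Definition detach_vertex : acmd :=
  AGet 9 2 $12 ;; AGet 10 1 $12 ;; ASet 10 ($10 :- $9) ;;
  AGet 18 3 $12 ;; AGet 19 3 $9 ;; AGet 23 3 $10 ;;
  AGet 13 4 ($19 :+ $12) ;; AGet 14 4 ($23 :+ $12) ;;
  APut 4 ($19 :+ $12) #0 ;; APut 4 ($23 :+ $12) #0 ;;
  APut 4 ($18 :+ $9) #0 ;; APut 4 ($18 :+ $10) #0 ;;
  APut 0 $12 #0 ;; APut 1 $12 #0 ;;
  AGet 20 0 $9 ;; APut 0 $9 ($20 :- #1) ;; AGet 20 0 $10 ;; APut 0 $10 ($20 :- #1) ;;
  AGet 20 1 $9 ;; APut 1 $9 ($20 :- $12) ;; AGet 20 1 $10 ;; APut 1 $10 ($20 :- $12).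

Definition push_neighbours : acmd :=
  APut 5 $7 $9 ;; APut 5 ($7 :+ #1) $10 ;; ASet 7 ($7 :+ #2).

Definition eliminate : acmd :=
  detach_vertex ;; make_ser ;; insert_edge ;; push_neighbours.

Definition pop_vertex : acmd := ASet 7 ($7 :- #1) ;; AGet 12 5 $7 ;; AGet 17 0 $12.

(** Stack entries may be repeated or outdated, hence the test after each pop; an eliminated vertex
    has degree 0 and fails it. *)
Definition is_candidate : test :=
  And (And (Not (Eq $12 $3)) (Not (Eq $12 $4))) (Eq $17 #2).

Definition reduce_graph : acmd :=
  AWhile (Le #1 $7) (pop_vertex ;; AIf is_candidate eliminate ASkip).

Definition eliminate_cost : nat :=
  acost detach_vertex + make_ser_cost + insert_cost + acost push_neighbours.

(** The factor 4 bounds the iterations per vertex: 1 for its initial stack entry and 3 for its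
    possible elimination. *)
Definition reduce_cost : nat :=
  4 * (acost pop_vertex + (test_cost is_candidate + (eliminate_cost + 1)).+1 +
       test_cost (Le #1 $7)).+1.

Section Reduce.
Variables (B l : nat) (G : ttgraph) (tau : 'I_(ne G) -> nat).
Notation V := 'I_(nv G).
Notation E := 'I_(ne G).
Notation n := (nv G).
Notation m := (ne G).
Notation tree_atG := (tree_at l (@nat_of_ord (ne G)) tau).
Notation graph_memG := (graph_mem l tau).
Implicit Types (g : V -> V -> option (tree E)) (u v w x y : V).

Lemma wsum_pair F (f : V -> bool) u w :
  u != w -> (forall x, f x = (x == u) || (x == w)) -> wsum F f = F u + F w.
Proof.
move=> uw fE.
have -> : F u = wsum F (fun x => x == u).
  rewrite -[LHS]add0n (_ : 0 = wsum F xpred0); last by rewrite /wsum big1.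
  by apply/esym/wsum_add; rewrite ?eqxx // => y /negbTE.
by apply: wsum_add; rewrite ?fE ?eqxx ?orbT //; [move=> y /negbTE; rewrite fE => ->; rewrite orbF | rewrite eq_sym].
Qed.

Lemma degree_card (f : V -> bool) : wsum (@degF G) f = #|[set x | f x]|.
Proof.
rewrite -sum1_card /wsum [RHS]big_mkcond /=; apply: eq_bigr => x _.
by rewrite inE muln1; case: (f x).
Qed.

Lemma two_neighbours (f : V -> bool) u :
  wsum (@degF G) f = 2 -> f u -> exists2 w, u != w & forall x, f x = (x == u) || (x == w).
Proof.
rewrite degree_card => /eqP/cards2P[x [y [xy e]]] fu.
have fE z : f z = (z == x) || (z == y) by have := in_set f z; rewrite e !inE => <-.
move: fu; rewrite fE => /orP[]/eqP ?; subst u; first by exists y.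
by exists x; [rewrite eq_sym | move=> z; rewrite fE orbC].
Qed.

Lemma wsum_delete F i g v x :
  tree_graph tau i g -> isSome (g x v) ->
  wsum F (fun y => isSome (g x y)) = wsum F (fun y => isSome (delete g v x y)) + F v.
Proof.
move=> tg gxv.
have xv : x != v by apply: contraTneq gxv => ->; rewrite (tg_irr tg).
apply: wsum_add => //; last by rewrite /delete eqxx orbT.
by move=> y yv; rewrite /delete (negbTE yv) (negbTE xv).
Qed.

Lemma detach_spec r a i g v u w Tu Tw :
  graph_memG r a g -> tree_graph tau i g -> r 12 = v -> a 2 v = u -> u != w ->
  (forall x, isSome (g v x) = (x == u) || (x == w)) ->
  g u v = Some Tu -> g w v = Some Tw -> (forall x, has_neighbour a g x) ->
  awp B detach_vertex (acost detach_vertex) r a (fun r1 a1 =>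
    [/\ graph_memG r1 a1 (delete g v) /\
        (forall x, x != u -> x != w -> has_neighbour a1 (delete g v) x),
        r1 9 = u /\ r1 10 = w, tree_atG (r1 6) a1 (r1 13) Tu /\ tree_atG (r1 6) a1 (r1 14) Tw,
        same [:: 9; 10; 13; 14; 18; 19; 20; 23] r r1 &
        forall k i, k \notin [:: 0; 1; 4] -> a1 k i = a k i]).
Proof.
move=> gm tg r12 nbv uw fE gu gw nb.
have [rl rH hrow hadj hdeg hsum] := gm.
have gu' : isSome (g u v) by rewrite gu.
have gw' : isSome (g w v) by rewrite gw.
have uv : u != v by apply: contraTneq gu' => ->; rewrite (tg_irr tg).
have wv : w != v by apply: contraTneq gw' => ->; rewrite (tg_irr tg).
have uvF : (nat_of_ord u == v) = false by rewrite (inj_eq val_inj) (negbTE uv).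
have wvF : (nat_of_ord w == v) = false by rewrite (inj_eq val_inj) (negbTE wv).
have wuF : (nat_of_ord w == u) = false by rewrite (inj_eq val_inj) eq_sym (negbTE uw).
have sumv : a 1 v = u + w by rewrite hsum (wsum_pair _ uw fE).
have du := hdeg u; rewrite (wsum_delete _ tg gu') /degF in du.
have dw := hdeg w; rewrite (wsum_delete _ tg gw') /degF in dw.
have su := hsum u; rewrite (wsum_delete _ tg gu') {2}/sumF in su.
have sw := hsum w; rewrite (wsum_delete _ tg gw') {2}/sumF in sw.
have [pu Ru] : 0 < a 4 (cell u v) /\ tree_atG (r 6) a (a 4 (cell u v)) Tu.
  by have := hadj u v; rewrite gu.
have [pw Rw] : 0 < a 4 (cell w v) /\ tree_atG (r 6) a (a 4 (cell w v)) Tw.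
  by have := hadj w v; rewrite gw.
apply: awp_straight; vcgen; rewrite ?r12 ?nbv ?sumv ?addKn ?hrow.
all: rewrite -?[nat_of_ord _ * n + _]/(cell _ _) ?updE ?wuF ?uvF ?wvF ?du ?dw ?su ?sw ?addnK ?leq_addr ?leq_addl //.
set a1 := aupd _ 1 w _; set r1 := upd _ 20 _.
have a1E k j : k \notin [:: 0; 1; 4] -> a1 k j = a k j.
  by move=> hk; rewrite /a1 !aupd_diff //; move: hk; rewrite !inE; lia.
have a1N k j : k \in [:: 6; 7; 8; 9] -> j < r 6 -> a1 k j = a k j.
  by move=> hk _; apply: a1E; move: hk; rewrite !inE; lia.
have delE x y : x != v -> ~~ isSome (g v x) -> delete g v x y = g x y.
  rewrite /delete => /negbTE-> h /=; case: eqP => // ->.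
  by rewrite (tg_sym tg); case: (g v x) h.
split=> //.
- split; first split=> //.
  + move=> x y; rewrite /a1 /= !updE !cell_eq /delete.
    have := hadj x y; have [->|xv] /= := eqVneq x v.
      rewrite ![v == _]eq_sym (negbTE uv) (negbTE wv) /= => h.
      case: eqP => //= yw; case: eqP => //= yu.
      have := fE y; move: h; case: (g v y) => //.
      by move/eqP: yw => /negbTE->; move/eqP: yu => /negbTE->.
    have [->|yv] /= := eqVneq y v.
      rewrite ?andbT; case: eqP => //= xw; case: eqP => //= xu.
      have := fE x; rewrite (tg_sym tg); case: (g x v) => //.
      by move/eqP: xw => /negbTE->; move/eqP: xu => /negbTE->.
    rewrite ?andbF /=; case: (g x y) => // T1 [p1 R1]; split=> //.
    exact: tree_at_frame a1N _ R1.
  + move=> x; rewrite /a1 /= !updE !(inj_eq val_inj).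
    have [->//|xw] := eqVneq x w; have [->//|xu] := eqVneq x u.
    have [->|xv] := eqVneq x v.
      by rewrite /wsum big1 // => y _; rewrite /delete eqxx.
    rewrite hdeg; apply: eq_wsum => y; rewrite delE //.
    by rewrite fE (negbTE xw) (negbTE xu).
  + move=> x; rewrite /a1 /= !updE !(inj_eq val_inj).
    have [->//|xw] := eqVneq x w; have [->//|xu] := eqVneq x u.
    have [->|xv] := eqVneq x v.
      by rewrite /wsum big1 // => y _; rewrite /delete eqxx.
    rewrite hsum; apply: eq_wsum => y; rewrite delE //.
    by rewrite fE (negbTE xw) (negbTE xu).
  + move=> x xu xw y; have [->|xv] := eqVneq x v; first by rewrite /delete eqxx.
    have nx : ~~ isSome (g v x) by rewrite fE (negbTE xw) (negbTE xu).
    rewrite delE // => /nb[z e gz]; exists z; first by rewrite a1E.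
    by rewrite delE.
- by split; [apply: tree_at_frame a1N _ Ru | apply: tree_at_frame a1N _ Rw].
- by move=> x; rewrite !inE => hx; rewrite /r1 !upd_diff //; lia.
Qed.

Definition eliminated i r a g v r' a' : Prop :=
  exists u w T, let g' := insert (delete g v) u w T in
  [/\ degree2 (source G) (sink G) (edge_set g) v u w,
      graph_memG r' a' g' /\ forall x, has_neighbour a' g' x,
      tree_graph tau i g' /\ extends tau i g',
      [/\ r' 7 = r 7 + 2, a' 5 (r 7) = u, a' 5 (r 7 + 1) = w &
          forall j, j < r 7 -> a' 5 j = a 5 j] &
      forall z : nat, z \in [:: 1; 2; 3; 4; 5] -> r' z = r z].

Lemma eliminate_spec r a i g v :
  graph_memG r a g -> tree_graph tau i g -> extends tau i g ->
  (forall x, has_neighbour a g x) ->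
  r 12 = v -> v != source G -> v != sink G -> a 0 v = 2 ->
  awp B eliminate (eliminate_cost * (l.+1 * l.+1)) r a (eliminated i r a g v).
Proof.
pose cs := make_ser_cost; pose ci := insert_cost.
have hs := @make_ser_spec B l _ (@nat_of_ord m) tau; rewrite -/cs in hs.
have hi := @insert_edge_spec B l G tau; rewrite -/ci in hi.
pose cd := acost detach_vertex; pose cp := acost push_neighbours.
rewrite -[eliminate_cost]/(cd + cs + ci + cp).
clearbody cs ci => gm tg eg nb r12 vs vt deg2.
apply: (@awp_weaken _ _ (cd + (cs * (l.+1 * l.+1) + (ci * l.+1 + cp))) _ _ _ _ _ _ _ (fun _ _ h => h)); last first.
  have : ci * l.+1 <= ci * (l.+1 * l.+1) by rewrite leq_mul2l leq_pmulr ?orbT.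
  have : cd <= cd * (l.+1 * l.+1) by rewrite leq_pmulr.
  have : cp <= cp * (l.+1 * l.+1) by rewrite leq_pmulr.
  by rewrite !mulnDl; clearbody cd cp; lia.
have deg2' := deg2; rewrite (gm_deg gm) in deg2'.
have [y gvy] : exists y, isSome (g v y).
  case: (pickP (fun y => isSome (g v y))) => [y gvy|none]; first by exists y.
  by move: deg2'; rewrite /wsum big1 // => y _; rewrite none.
have [u nbv gvu] := nb v y gvy.
have [w uw fE] := two_neighbours deg2' gvu.
have [Tu gu] : exists T, g u v = Some T by move: gvu; rewrite (tg_sym tg); case: (g u v) => // T; exists T.
have [Tw gw] : exists T, g w v = Some T.
  have : isSome (g v w) by rewrite fE eqxx orbT.
  by rewrite (tg_sym tg); case: (g w v) => // T; exists T.
have d2 : degree2 (source G) (sink G) (edge_set g) v u w.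
  by split=> // x; rewrite in_edge_set fE.
apply: awp_seq; apply: awp_weaken (detach_spec gm tg r12 nbv uw fE gu gw nb) (leqnn _) _.
move=> r1 a1 [[gm1 nb1] [e9 e10] [Ru Rw] s1 f1].
apply: awp_seq; apply: awp_weaken (hs r1 a1 Tu Tw (gm_l gm1) Ru Rw) (leqnn _) _.
move=> r2 a2 [q1 q2 q3 q4 q5].
have gm2 : graph_memG r2 a2 (delete g v).
  apply: graph_mem_frame gm1 _ _ q4; first by rewrite q3.
  by rewrite q1 -addnA leq_addr.
apply: awp_seq.
apply: awp_weaken (hi r2 a2 i (delete g v) u w (Ser Tu Tw) gm2 (tree_graph_delete v tg) uw _ _ _ q5 _) (leqnn _) _.
- by rewrite q3.
- by rewrite q3.
- by rewrite q2; apply: gm_H gm1.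
- by move=> x xu xw z gz; rewrite q4; [exact: nb1 gz | left].
move=> r3 a3 [w1 w2 w3 w4].
have e7 : r3 7 = r 7 by rewrite w3 // q3 // s1.
have e9' : r3 9 = u by rewrite w3 // q3.
have e10' : r3 10 = w by rewrite w3 // q3.
have e5 j : a3 5 j = a 5 j by rewrite w4 // q4 ?f1 //; left.
apply: awp_straight; vcgen; rewrite e7 e9' e10'.
exists u, w, (Ser Tu Tw); split=> //.
- split.
    case: w1 => k1 k2 k3 k4 k5 k6; split=> // x z /=; have := k4 x z.
    case: (insert _ _ _ _ x z) => // T1 [p1 R1]; split=> //.
    by apply: tree_at_frame R1 => // k j; rewrite !inE => /or4P[] /eqP->.
  by [].
- by split; [exact: tree_graph_elim d2 gu gw | exact: extends_elim d2 gu gw eg].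
- split=> /=.
  + by [].
  + by rewrite upd_diff ?upd_same //; lia.
  + by rewrite upd_same.
  + by move=> j hj; rewrite !upd_diff ?e5 //; lia.
- move=> x hx; rewrite upd_diff ?w3 ?q3 ?s1 //; move: hx; rewrite !inE; lia.
Qed.

Definition alive g : {set V} := [set x | [exists y, isSome (g x y)]].

Lemma aliveP g x : reflect (exists y, isSome (g x y)) (x \in alive g).
Proof. by rewrite inE; exact: existsP. Qed.

(** The vertex [v] becomes isolated, and no isolated vertex gains a neighbour, since [u] and [w]
    were neighbours of [v]. *)
Lemma alive_elim i g v u w T :
  tree_graph tau i g -> degree2 (source G) (sink G) (edge_set g) v u w ->
  #|alive (insert (delete g v) u w T)| < #|alive g|.
Proof.
move=> tg [_ _ _ nbv].
have gv x : isSome (g v x) = (x == u) || (x == w) by rewrite -nbv in_edge_set.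
have gx x : (x == u) || (x == w) -> x \in alive g :\ v.
  rewrite -gv in_setD1 => gvx; apply/andP; split.
    by apply: contraTneq gvx => ->; rewrite (tg_irr tg).
  by apply/aliveP; exists v; rewrite (tg_sym tg).
rewrite [X in _ < X](cardsD1 v); have -> : v \in alive g.
  by apply/aliveP; exists u; rewrite gv eqxx.
rewrite add1n ltnS; apply/subset_leq_card/subsetP => x /aliveP[y].
rewrite /insert; case: ifP => [/orP[]/andP[/eqP-> _] _|_].
- by apply: gx; rewrite eqxx.
- by apply: gx; rewrite eqxx orbT.
rewrite /delete; case: ifP => // /norP[xv _] gxy.
by rewrite in_setD1 xv; apply/aliveP; exists y.
Qed.

(** Only [v], [u] and [w] change their neighbourhoods, so the stack remains complete once [u] and
    [w] have been pushed. *)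
Lemma degree2_elim g v u w T x y z :
  (forall a b, g a b = g b a) ->
  degree2 (source G) (sink G) (edge_set g) v u w ->
  degree2 (source G) (sink G) (edge_set (insert (delete g v) u w T)) x y z ->
  [\/ x = u, x = w | x != v /\ degree2 (source G) (sink G) (edge_set g) x y z].
Proof.
move=> symg [_ _ _ nbv] [xs xt yz nbx].
have [->|xu] := eqVneq x u; first by constructor 1.
have [->|xw] := eqVneq x w; first by constructor 2.
constructor 3; have xv : x != v.
  apply/eqP => xv; have := nbx y; rewrite edge_set_elim in_elim xv eqxx andbF -xv.
  by rewrite (negbTE xu) (negbTE xw) eqxx.
split=> //; split=> // p; rewrite -nbx edge_set_elim in_elim (negbTE xu) (negbTE xw) xv !orbF /=.
have [->|] := eqVneq p v; last by rewrite andbT.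
rewrite andbF; apply/negbTE; have := nbv x; rewrite (negbTE xu) (negbTE xw) !in_edge_set /= symg.
by move=> ->.
Qed.

(** Every vertex that can be eliminated is on the stack; an empty stack therefore certifies that a
    reducible graph has become the edge [st]. *)
Definition stacked r (a : nat -> nat -> nat) g : Prop :=
  (forall j, j < r 7 -> exists v : V, a 5 j = v) /\
  forall v u w, degree2 (source G) (sink G) (edge_set g) v u w ->
    exists2 j, j < r 7 & a 5 j = v.

Lemma reduce_graph_spec r a g :
  graph_memG r a g -> tree_graph tau m g -> extends tau m g ->
  (forall x, has_neighbour a g x) -> stacked r a g ->
  reducible (source G) (sink G) (edge_set g) ->
  r 3 = source G -> r 4 = sink G -> r 7 = n ->
  awp B reduce_graph (reduce_cost * (n.+1 * (l.+1 * l.+1))) r a (fun r' a' =>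
    exists g', [/\ graph_memG r' a' g', tree_graph tau m g', extends tau m g',
      edge_set g' = uedge (source G) (sink G) &
      forall z : nat, z \in [:: 1; 2; 3; 4; 5] -> r' z = r z]).
Proof.
pose ce := eliminate_cost; have he := eliminate_spec; rewrite -/ce in he.
pose cp := acost pop_vertex; pose cc := test_cost is_candidate; pose ct := test_cost (Le #1 $7).
rewrite -[reduce_cost]/(4 * (cp + (cc + (ce + 1)).+1 + ct).+1).
clearbody ce => gm tg eg nb st red r3 r4 r7.
pose L := l.+1 * l.+1.
have L1 : 0 < L by rewrite muln_gt0.
(* The amortised measure: a plain pop lowers it by 1; an elimination pops one entry, pushes two and
   lowers the second summand by at least 3. *)
pose N := r 7 + 3 * #|alive g|.
have leN : N <= 4 * n.
  have : #|alive g| <= n by rewrite -[X in _ <= X]card_ord; exact: max_card.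
  by rewrite /N r7; lia.
apply: (@awp_weaken _ _ ((cp + (cc + (ce * L + 1)).+1 + ct).+1 * N.+1) _ _ _ _ _ _ _ (fun _ _ h => h)); last first.
  have h : (cp + (cc + (ce * L + 1)).+1 + ct).+1 <= (cp + (cc + (ce + 1)).+1 + ct).+1 * L.
    by clearbody cp cc ct L; nia.
  have hN : N.+1 <= 4 * n.+1 by rewrite mulnS; lia.
  apply: leq_trans (leq_mul h hN) _.
  by rewrite -/L mulnACA (mulnC _ 4) (mulnC L) leqnn.
apply: (awp_while (I := fun N r' a' => exists g',
   [/\ graph_memG r' a' g', tree_graph tau m g' /\ extends tau m g',
      (forall x, has_neighbour a' g' x) /\ stacked r' a' g',
      reducible (source G) (sink G) (edge_set g') &
      (forall z : nat, z \in [:: 1; 2; 3; 4; 5] -> r' z = r z) /\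
      N = r' 7 + 3 * #|alive g'|])) => //.
- move=> {g gm tg eg nb st red leN} {}N r1 a1 [g [gm [tg eg] [nb [st1 st2]] red [sr eN]]] /= r7pos.
  apply: awp_straight_seq; vcgen.
  have [v av] : exists v : V, a1 5 (r1 7 - 1) = v by apply: st1; lia.
  rewrite !av; set r2 := upd _ 17 _.
  have e3 : r2 3 = source G by rewrite -r3 -sr.
  have e4 : r2 4 = sink G by rewrite -r4 -sr.
  have gm2 : graph_memG r2 a1 g by case: gm.
  apply: awp_if => //=.
    rewrite e3 e4 !(inj_eq val_inj) => /andP[/andP[vs vt] /eqP d2].
    apply: awp_weaken (he r2 a1 m g v gm2 tg eg nb erefl vs vt d2) _ _; first by rewrite -/L; lia.
    move=> r' a' [u [w [T [dg [gm' nb'] [tg' eg'] [q1 q2 q3 q4] sr']]]].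
    have al := alive_elim T tg dg.
    have e7 : r2 7 = r1 7 - 1 by [].
    rewrite e7 in q1 q2 q3 q4.
    eexists; last exists (insert (delete g v) u w T); last split=> //.
    + by rewrite eN; apply: leq_ltn_trans (_ : _ <= r' 7 + 3 * #|alive (insert (delete g v) u w T)|) _; [exact: leqnn | lia].
    + split=> //; split.
        move=> j; rewrite q1 => hj; have [lt|] := ltnP j (r1 7 - 1).
          by rewrite q4 //; apply: st1; lia.
        have [->|ne] := eqVneq j (r1 7 - 1); first by exists u.
        move=> ge; exists w; rewrite -q3; congr (a' 5 _); lia.
      move=> x y z /(degree2_elim (tg_sym tg) dg)[->|->|[xv /st2[j jlt ej]]].
      * by exists (r1 7 - 1) => //; lia.
      * by exists (r1 7 - 1 + 1) => //; lia.
      have jne : j != r1 7 - 1.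
        by apply: contraNneq xv => je; rewrite -(inj_eq val_inj) /= -ej je av.
      by exists j; [lia | rewrite q4 //; lia].
    + by rewrite edge_set_elim; apply: reducible_elim_any red (simple_edge_set tg) dg.
    + by split=> // z hz; rewrite sr' // -sr //; move: hz; rewrite !inE => /or4P[||| /orP[]] /eqP->.
  move=> nc; apply: (@awp_weaken _ _ (acost ASkip)); last 2 first.
    by rewrite /=; lia.
    by move=> r' a'; exact.
  apply: awp_straight; vcgen.
  have e7 : r2 7 = r1 7 - 1 by [].
  eexists; last exists g; last split=> //.
  + by rewrite eN; apply: leq_ltn_trans (_ : _ <= r2 7 + 3 * #|alive g|) _; [exact: leqnn | lia].
  + split=> //; split; rewrite e7; first by move=> j hj; apply: st1; lia.
    move=> x y z d2; have [j jlt ej] := st2 _ _ _ d2.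
    (* The discarded entry is not the one recorded for [x], because an inner vertex of degree two
       would have passed the test. *)
    exists j => //; suff : j != r1 7 - 1 by lia.
    apply: contraNneq nc => je; have xv : x = v by apply: val_inj; rewrite /= -ej je av.
    subst x; case: d2 => vs vt yz nbv; rewrite e3 e4 !(inj_eq val_inj) vs vt /=.
    rewrite -[r2 17]/(a1 0 v) (gm_deg gm) (wsum_pair _ yz) // => x.
    by rewrite -nbv in_edge_set.
  + by split=> // z hz; rewrite -sr //; move: hz; rewrite !inE => /or4P[||| /orP[]] /eqP->.
- move=> {g gm tg eg nb st red leN} {}N r1 a1 [g [gm [tg eg] [nb [st1 st2]] red [sr eN]]] /= r7pos.
  exists g; split=> //; apply: reducible_terminal red _ => v u w /st2[j]; lia.
by exists g.
Qed.

End Reduce.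

(** * Reading an optimal set off the tables *)

Definition start_trace : acmd :=
  AGet 18 3 $3 ;; AGet 11 4 ($18 :+ $4) ;; APut 10 #0 $11 ;; APut 11 #0 $5 ;;
  ASet 7 #1 ;; ASet 8 #0.

Definition pop_node : acmd :=
  ASet 7 ($7 :- #1) ;; AGet 11 10 $7 ;; AGet 15 11 $7 ;; AGet 17 7 $11 ;;
  AGet 13 8 $11 ;; AGet 14 9 $11 ;; AGet 20 6 ($11 :+ $15).

(** A table entry 1 at a leaf means that the edge is deleted. The output overwrites the input from
    cell 1 on; cell 0 receives the count at the end. *)
Definition emit_edge : acmd :=
  AIf (Eq $20 #0) ASkip (ASet 8 ($8 :+ #1) ;; APut 16 $8 $13).

Definition next_split : acmd :=
  ASet 16 ($16 :+ #1) ;; AGet 21 6 ($13 :+ $16) ;; AGet 22 6 ($14 :+ ($15 :- $16)) ;;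
  ASet 21 ($21 :+ $22).

Definition first_split : acmd :=
  ASet 16 #0 ;; AGet 21 6 $13 ;; AGet 22 6 ($14 :+ $15) ;; ASet 21 ($21 :+ $22).

(** The tables do not record their minimisers; one is searched for again, in time linear in [l] per
    node. *)
Definition find_split : acmd :=
  first_split ;;
  AWhile (Not (Eq $21 $20)) next_split ;;
  ASet 19 ($15 :- $16).

Definition push_children : acmd :=
  APut 10 $7 $13 ;; APut 11 $7 $16 ;; APut 10 ($7 :+ #1) $14 ;; APut 11 ($7 :+ #1) $19 ;;
  ASet 7 ($7 :+ #2).

Definition split_targets : acmd :=
  AIf (Eq $17 #1) find_split (ASet 16 $15 ;; ASet 19 $15).

Definition trace_node : acmd :=
  pop_node ;; AIf (Eq $17 #0) emit_edge (split_targets ;; push_children).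

Definition trace : acmd :=
  start_trace ;; AWhile (Le #1 $7) trace_node ;; APut 16 #0 $8.

Definition find_split_cost : nat :=
  acost first_split +
  ((acost next_split + test_cost (Not (Eq $21 $20))).+1 + acost (ASet 19 ($15 :- $16))).

Definition split_targets_cost : nat :=
  (test_cost (Eq $17 #1) + (find_split_cost + acost (ASet 16 $15 ;; ASet 19 $15))).+1.

Definition trace_node_cost : nat :=
  acost pop_node +
  (test_cost (Eq $17 #0) +
   (acost emit_edge + (split_targets_cost + acost push_children))).+1.

(** The factor 2 reflects that a tree has fewer than twice as many nodes as leaves. *)
Definition trace_cost : nat :=
  acost start_trace + 2 * (trace_node_cost + test_cost (Le #1 $7)).+1 + acost (APut 16 #0 $8).

Lemma iota0_rcons k : iota 0 k.+1 = rcons (iota 0 k) k.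
Proof. by rewrite -addn1 iotaD cats1. Qed.

Section Trace.
Variables (B l m : nat) (tau : 'I_m -> nat).
Notation E := 'I_m.
Notation tree_atG := (tree_at l (@nat_of_ord m) tau).
Implicit Types (T : tree E) (st : seq (tree E * nat)) (O : seq E) (a : nat -> nat -> nat).
Hypothesis mB : m < B.

Lemma find_split_spec r a f g :
  (forall j, j <= l -> a 6 (r 13 + j) = f j) -> (forall j, j <= l -> a 6 (r 14 + j) = g j) ->
  r 15 <= l -> r 20 = minsum f g (r 15) (r 15) ->
  awp B find_split (find_split_cost * l.+1) r a (fun r' a' =>
    [/\ a' = a, same [:: 16; 19; 21; 22] r r', r' 16 + r' 19 = r 15 &
        f (r' 16) + g (r' 19) = r 20]).
Proof.
pose c0 := acost first_split.
pose c1 := acost next_split; pose ct := test_cost (Not (Eq $21 $20)).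
pose c2 := acost (ASet 19 ($15 :- $16)).
rewrite -[find_split_cost]/(c0 + ((c1 + ct).+1 + c2)) => hf hg r15 r20.
(* The minimiser [i0] bounds the search, which may stop earlier at another one. *)
have [i0 le_i0 ei0] := minsum_witness f g (r 15) (r 15); rewrite -r20 in ei0.
apply: (@awp_weaken _ _ (c0 + ((c1 + ct).+1 * i0.+1 + c2)) _ _ _ _ _ _ _ (fun _ _ h => h)); last first.
  have : (c1 + ct).+1 * i0.+1 <= (c1 + ct).+1 * l.+1 by rewrite leq_mul2l; lia.
  have : c0 <= c0 * l.+1 by rewrite leq_pmulr.
  have : c2 <= c2 * l.+1 by rewrite leq_pmulr.
  by rewrite !mulnDl; clearbody c0 c1 c2 ct; lia.
apply: awp_straight_seq; vcgen; apply: awp_seq.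
apply: (awp_while (I := fun N r' a' =>
    [/\ a' = a, same [:: 16; 21; 22] r r', r' 16 + N = i0 &
        r' 21 = f (r' 16) + g (r 15 - r' 16)])) => //.
- move=> N r' a' [-> s1 h1 h2]; rewrite /= (s1 20) // h2 => ne.
  have lt : r' 16 < i0.
    by rewrite ltn_neqAle; apply/andP; split; [apply: contraNneq ne => ->; rewrite ei0 | lia].
  apply: awp_straight; vcgen; rewrite ?(s1 15) ?(s1 13) ?(s1 14) //=; first lia.
  exists N.-1; first lia.
  split=> //=.
  + by move=> x hx; rewrite !upd_diff ?s1 //; move: hx; rewrite !inE; lia.
  + lia.
  + by rewrite hf ?hg //; lia.
- move=> N r' a' [-> s1 h1 h2]; rewrite /= (s1 20) // h2 negbK => /eqP e.
  apply: awp_straight; vcgen; rewrite ?(s1 15) //=; try lia.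
  by move=> x hx; rewrite !upd_diff ?s1 //; move: hx; rewrite !inE; lia.
split=> //=.
- by move=> x hx; rewrite !upd_diff ?s1 //; move: hx; rewrite !inE; lia.
- by rewrite -[r 13]addn0 hf // hg // subn0.
Qed.

Fixpoint stack_at (H : nat) a st : Prop :=
  if st is (T, j) :: st' then
    [/\ tree_atG H a (a 10 (size st')) T, a 11 (size st') = j, j <= l & stack_at H a st']
  else True.

Lemma stack_at_frame H a a' st :
  (forall k i, k \in [:: 6; 7; 8; 9] -> a' k i = a k i) ->
  (forall k i, k \in [:: 10; 11] -> i < size st -> a' k i = a k i) ->
  stack_at H a st -> stack_at H a' st.
Proof.
move=> h1; elim: st => [|[T j] st IH] //= h2 [q1 q2 q3 q4].
split=> //; [|by rewrite h2|].
  by rewrite h2 //; apply: tree_at_frame q1 => // k i hk _; exact: h1.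
by apply: IH => // k i hk hi; apply: h2 => //; exact: ltnW.
Qed.

Definition stack_leaves st := flatten [seq leaves x.1 | x <- st].
Definition stack_cost st := sumn [seq copt tau x.1 x.2 | x <- st].
Definition stack_size st := sumn [seq tree_size x.1 | x <- st].

(** The stack lists pending goals, each a tree with the distance it has to reach. Emitted edges and
    the optimal costs of the goals always add up to the optimum, and any superset of the emitted
    edges that meets all goals cuts [T0]; with an empty stack this is optimal cost and feasibility.
    Distinctness limits the output to [m] edges, so that all writes stay below [B]. *)
Record traced (T0 : tree E) r a O st : Prop := Traced {
  tr_l : r 5 = l;
  tr_7 : r 7 = size st;
  tr_st : stack_at (r 6) a st;
  tr_8 : r 8 = size O;
  tr_out : [seq a 16 i.+1 | i <- iota 0 (size O)] = [seq nat_of_ord e | e <- O];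
  tr_uniq : uniq (O ++ stack_leaves st);
  tr_cost : size O + stack_cost st = copt tau T0 l;
  tr_cut : forall S : {set E}, {subset O <= S} ->
    (forall x, x \in [seq cut tau S x.1 x.2 | x <- st] -> x) -> cut tau S T0 l }.

Lemma size_uniq_ord O : uniq O -> size O <= m.
Proof. by move/card_uniqP<-; rewrite -[X in _ <= X]card_ord; exact: max_card. Qed.

Definition splits T T1 T2 j j1 j2 : Prop :=
  [/\ copt tau T j = copt tau T1 j1 + copt tau T2 j2,
      forall S : {set E}, cut tau S T1 j1 -> cut tau S T2 j2 -> cut tau S T j,
      leaves T = leaves T1 ++ leaves T2 & tree_size T = (tree_size T1 + tree_size T2).+1].

Lemma split_targets_spec r a T T1 T2 :
  (T = Ser T1 T2 /\ r 17 = 1) \/ (T = Par T1 T2 /\ r 17 = 2) ->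
  tree_atG (r 6) a (r 13) T1 -> tree_atG (r 6) a (r 14) T2 ->
  r 15 <= l -> r 20 = copt tau T (r 15) ->
  awp B split_targets (split_targets_cost * l.+1) r a (fun r' a' =>
    [/\ a' = a, same [:: 16; 19; 21; 22] r r', r' 16 <= l /\ r' 19 <= l &
        splits T T1 T2 (r 15) (r' 16) (r' 19)]).
Proof.
pose c := find_split_cost; have hc := find_split_spec; rewrite -/c in hc.
pose ct := test_cost (Eq $17 #1); pose cp := acost (ASet 16 $15 ;; ASet 19 $15).
rewrite -[split_targets_cost]/(ct + (c + cp)).+1.
clearbody c => hT R1 R2 r15 r20.
apply: (@awp_weaken _ _ (ct + (c * l.+1 + cp)).+1 _ _ _ _ _ _ _ (fun _ _ h => h)); last first.
  by clearbody ct cp; nia.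
apply: awp_if => //=.
  case: hT => [[eT _]|[_ ->]] // _; subst T.
  apply: awp_weaken (hc r a _ _ (fun j => tree_at_table R1 (j := j))
    (fun j => tree_at_table R2 (j := j)) r15 r20) (leq_addr _ _) _.
  move=> r' a' [-> s1 e1 e2]; split=> //; first by split; lia.
  split=> //; first by rewrite e2.
  move=> S c1 c2; apply/cut_serP; exists (r' 16); split=> //; first lia.
  by have -> : r 15 - r' 16 = r' 19 by lia.
case: hT => [[_ ->]|[eT _]] // _; subst T.
apply: awp_weaken (awp_straight (Q := fun r' a' =>
    [/\ a' = a, same [:: 16; 19; 21; 22] r r', r' 16 <= l /\ r' 19 <= l &
        splits (Par T1 T2) T1 T2 (r 15) (r' 16) (r' 19)]) _) _ _ => //; last exact: leq_addl.
vcgen.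
- by move=> x; rewrite !inE => hx; rewrite !upd_diff //; lia.
- by split=> // S c1 c2; rewrite cut_par c1.
Qed.

Lemma trace_node_spec T0 r a O st :
  traced T0 r a O st -> 0 < r 7 ->
  awp B trace_node (trace_node_cost * l.+1) r a (fun r' a' => exists O' st',
    [/\ traced T0 r' a' O' st', stack_size st' < stack_size st &
        forall k i, k \notin [:: 10; 11; 16] -> a' k i = a k i]).
Proof.
pose cs := split_targets_cost; have hs := split_targets_spec; rewrite -/cs in hs.
pose cp := acost pop_node; pose ce := acost emit_edge; pose cc := acost push_children.
pose ct := test_cost (Eq $17 #0).
rewrite -[trace_node_cost]/(cp + (ct + (ce + (cs + cc))).+1).
clearbody cs; case: st => [|[T j] st]; first by case=> _ ->.
case=> rl r7 [R0 a11 jl Rst] r8 out uO cost cutO _.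
apply: (@awp_weaken _ _ (cp + (ct + (ce + (cs * l.+1 + cc))).+1) _ _ _ _ _ _ _ (fun _ _ h => h)); last first.
  by clearbody cp ce cc ct; nia.
have e7 : r 7 - 1 = size st by rewrite r7 /= subn1.
apply: awp_straight_seq; vcgen; first by rewrite r7.
clear r7.
rewrite !e7 a11; set p := a 10 (size st) in R0 *.
have tab := tree_at_table R0 jl; rewrite tab.
set r1 := upd _ 20 _.
apply: awp_if => //=.
  move=> k0; have {}k0 : a 7 p = 0 by exact/eqP.
  apply: (@awp_weaken _ _ (acost emit_edge)); last 2 first.
    by rewrite -/ce; exact: leq_addr.
    by move=> r' a'; exact.
  have [e eT a8] : exists2 e, T = Leaf e & a 8 p = e.
    case: (T) R0 => [e|T1 T2|T1 T2] [_ _]; last 2 first.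
    - by case; rewrite k0.
    - by case; rewrite k0.
    by case=> _ ->; exists e.
  rewrite eT in cost cutO uO.
  have u1 : uniq (rcons O e ++ stack_leaves st) by rewrite cat_rcons.
  have szO : (size O).+1 <= m.
    by move: u1; rewrite cat_uniq => /andP[/size_uniq_ord]; rewrite size_rcons.
  have e20 : r1 20 = (tau e < j) by rewrite -[LHS]/(copt tau T j) eT.
  have e8 : r1 8 = size O by rewrite -r8.
  apply: awp_straight; vcgen; rewrite e20; case: ltnP => hj; vcgen; rewrite ?e8 ?addn1 //.
  + by rewrite andbT; exact: leq_ltn_trans mB.
  + rewrite eT; exists (rcons O e), st; split=> //; last first.
      by move=> k i hk; rewrite aupd_diff //; move: hk; rewrite !inE; lia.
    split=> //=.
    * by apply: stack_at_frame Rst => k i; rewrite !inE => hk; try move=> _; rewrite aupd_diff //; lia.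
    * by rewrite size_rcons.
    * rewrite size_rcons iota0_rcons !map_rcons; congr rcons.
        rewrite -out; apply/eq_in_map => i; rewrite mem_iota => hi.
        by rewrite -[LHS]/(upd (a 16) (size O).+1 (r1 13) i.+1) upd_diff //; lia.
      by rewrite -[LHS]/(upd (a 16) (size O).+1 (r1 13) (size O).+1) upd_same -a8.
    * move: cost; rewrite /stack_cost /= hj size_rcons => <-; lia.
    * move=> S sO cS; apply: cutO => [e' he'|b].
        by apply: sO; rewrite mem_rcons inE he' orbT.
      rewrite inE => /predU1P[->|/cS//]; rewrite cut_leaf sO //.
      by rewrite mem_rcons inE eqxx.
  + rewrite eT; exists O, st; split=> //.
    split=> //=.
    * by move: u1; rewrite cat_rcons -cat1s !cat_uniq /= => /and3P[-> /norP[_ ->] /andP[_ ->]].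
    * by move: cost; rewrite /stack_cost /= ltnNge hj.
    * move=> S sO cS; apply: cutO => // b.
      by rewrite inE => /predU1P[->|/cS//]; rewrite cut_leaf hj orbT.
move=> k0; have {}k0 : a 7 p != 0 by exact: k0.
apply: (@awp_weaken _ _ (cs * l.+1 + cc)); last 2 first.
  by exact: leq_addl.
  by move=> r' a'; exact.
have [T1 [T2 [hT R1 R2]]] : exists T1 T2,
    [/\ (T = Ser T1 T2 /\ r1 17 = 1) \/ (T = Par T1 T2 /\ r1 17 = 2),
        tree_atG (r1 6) a (r1 13) T1 & tree_atG (r1 6) a (r1 14) T2].
  case: (T) R0 => [e|T1 T2|T1 T2] [_ _].
  - by case=> h; rewrite h in k0.
  - by case=> h1 h2 h3; exists T1, T2; split=> //; left.
  - by case=> h1 h2 h3; exists T1, T2; split=> //; right.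
apply: awp_seq.
apply: awp_weaken (hs r1 a T T1 T2 hT R1 R2 jl erefl) (leqnn _) _.
move=> r2 a2 [-> s2 [l1 l2] [sp1 sp2 sp3 sp4]].
have f7 : r2 7 = size st by rewrite s2.
have f13 : r2 13 = r1 13 by rewrite s2.
have f14 : r2 14 = r1 14 by rewrite s2.
apply: awp_straight; vcgen; rewrite f7 f13 f14.
exists O, [:: (T2, r2 19), (T1, r2 16) & st]; split; last first.
- by move=> k i; rewrite !inE => hk; rewrite !aupd_diff //; lia.
- by rewrite /stack_size /= sp4; lia.
split=> /=.
- by rewrite s2.
- by lia.
- have fr (a' : nat -> nat -> nat) : (forall k i, k \in [:: 6; 7; 8; 9] -> a' k i = a k i) ->
    forall k i, k \in [:: 6; 7; 8; 9] -> i < r1 6 -> a' k i = a k i by move=> h k i hk _; exact: h.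
  rewrite s2 //; split=> //.
  + rewrite /= !updE addn1 eqxx; apply: tree_at_frame R2 => //; apply: fr.
    by move=> k i; rewrite !inE => hk; rewrite !aupd_diff //; lia.
  + by rewrite !updE addn1 eqxx.
  split=> //.
  + rewrite /= !updE addn1 eqxx.
    have -> : (size st == (size st).+1) = false by lia.
    apply: tree_at_frame R1 => //; apply: fr.
    by move=> k i; rewrite !inE => hk; rewrite !aupd_diff //; lia.
  + rewrite !updE addn1 eqxx; have -> : (size st == (size st).+1) = false by lia.
    by [].
  apply: stack_at_frame Rst => k i.
    by rewrite !inE => hk; rewrite !aupd_diff //; lia.
  by rewrite !inE => /orP[]/eqP-> hi /=; rewrite !upd_diff //; lia.
- by rewrite s2 // -r8.
- by rewrite -out.
- move: uO; rewrite /stack_leaves /= sp3 -!catA; apply: etrans; apply: perm_uniq.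
  by rewrite perm_cat2l perm_catCA.
- by rewrite -cost /stack_cost /= sp1; lia.
- move=> S sO cS; apply: cutO => // b; rewrite inE => /predU1P[->|hb].
    by apply: sp2; apply: cS; rewrite !inE eqxx ?orbT.
  by apply: cS; rewrite !inE hb !orbT.
Qed.

Definition written (T0 : tree E) (a : nat -> nat -> nat) : Prop :=
  exists O, [/\ uniq O, size O = copt tau T0 l, cut tau [set e in O] T0 l,
    a 16 0 = size O &
    [seq a 16 i.+1 | i <- iota 0 (size O)] = [seq nat_of_ord e | e <- O]].

Lemma trace_spec r a T0 :
  r 5 = l -> tree_atG (r 6) a (a 4 (a 3 (r 3) + r 4)) T0 -> uniq (leaves T0) ->
  awp B trace (trace_cost * (m.+1 * l.+1)) r a (fun r' a' => written T0 a').
Proof.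
pose c := trace_node_cost; have hc := trace_node_spec; rewrite -/c in hc.
pose c0 := acost start_trace; pose ct := test_cost (Le #1 $7); pose c1 := acost (APut 16 #0 $8).
rewrite -[trace_cost]/(c0 + 2 * (c + ct).+1 + c1).
clearbody c => rl R0 uT0.
have sz : tree_size T0 < 2 * m.+1.
  apply: leq_trans (tree_size_leaves T0) _.
  by rewrite leq_mul2l /= (leq_trans (size_uniq_ord uT0)).
apply: (@awp_weaken _ _ (c0 + ((c * l.+1 + ct).+1 * (tree_size T0).+1 + c1)) _ _ _ _ _ _ _ (fun _ _ h => h)); last first.
  have h : (c * l.+1 + ct).+1 <= (c + ct).+1 * l.+1 by clearbody ct; nia.
  have hA := leq_mul h sz; rewrite mulnACA (mulnC _ 2) (mulnC l.+1) in hA.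
  have h0 : c0 <= c0 * (m.+1 * l.+1) by rewrite leq_pmulr ?muln_gt0.
  have h1 : c1 <= c1 * (m.+1 * l.+1) by rewrite leq_pmulr ?muln_gt0.
  by rewrite addnA 2!mulnDl; apply: leq_add h1; exact: leq_add.
apply: awp_straight_seq; vcgen; apply: awp_seq.
set p := a 4 _ in R0 *.
apply: (awp_while (I := fun N r' a' => exists O st,
  traced T0 r' a' O st /\ N = stack_size st)) => //.
- move=> N r' a' [O [st [tr ->]]] /= r7.
  apply: awp_weaken (hc T0 r' a' O st tr r7) (leqnn _) _.
  by move=> r1 a1 [O' [st' [tr' lt _]]]; exists (stack_size st') => //; exists O', st'.
- move=> N r' a' [O [st [tr _]]] /= r7.
  have st0 : st = [::].
    by apply/nilP; rewrite /nilp -(tr_7 tr); move: r7; case: (r' 7).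
  case: tr => _ _ _ r8 out uO cost cutO; rewrite st0 in uO cost cutO.
  apply: awp_straight; vcgen; first by rewrite andbT; exact: leq_ltn_trans mB.
  exists O; split=> //.
  + by move: uO; rewrite /stack_leaves /= cats0.
  + by rewrite -cost /stack_cost /= addn0.
  + by apply: cutO => // e he; rewrite inE.
exists [::], [:: (T0, l)]; split; last by rewrite /stack_size /= addn0.
split=> //=.
- split=> //; apply: tree_at_frame R0 => // k i.
  by rewrite !inE => hk _; rewrite !aupd_diff //; lia.
- by rewrite /stack_leaves /= cats0.
- by rewrite /stack_cost /= addn0.
- by move=> S _ h; apply: h; rewrite inE.
Qed.

End Trace.

(** * The whole program and its running time *)

Definition solve : acmd := init_vertices ;; read_edges ;; reduce_graph ;; trace.

(** The coefficients come from [n + 1 <= 3 * m], [m + 1 <= 2 * m] and [l + 1 <= 2 * l], where [n] is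
    the number of vertices and both [m] and [l] are positive. *)
Definition solve_cost : nat := 3 * init_cost + 4 * read_cost + 12 * reduce_cost + 4 * trace_cost.

Lemma solve_time_bound (ci cr cd ct n m l : nat) :
  0 < l -> 0 < m -> n <= 2 * m ->
  ci * n.+1 + (cr * (m.+1 * l.+1) + (cd * (n.+1 * (l.+1 * l.+1)) + ct * (m.+1 * l.+1))) <=
  (3 * ci + 4 * cr + 12 * cd + 4 * ct) * (m * l ^ 2).
Proof.
move=> l0 m0 nm.
have hn : n.+1 <= 3 * m by lia.
have hm : m.+1 <= 2 * m by lia.
have hl : l.+1 <= 2 * l by lia.
have ll : l <= l ^ 2 by rewrite expnS expn1 leq_pmull.
have h1 : n.+1 <= 3 * (m * l ^ 2).
  by apply: leq_trans hn _; rewrite leq_mul2l /= leq_pmulr // expn_gt0 l0.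
have h2 : m.+1 * l.+1 <= 4 * (m * l ^ 2).
  apply: leq_trans (leq_mul hm hl) _; rewrite mulnACA leq_mul2l /= leq_mul2l ll.
  by rewrite orbT.
have h3 : n.+1 * (l.+1 * l.+1) <= 12 * (m * l ^ 2).
  apply: leq_trans (leq_mul hn (leq_mul hl hl)) _.
  by rewrite (mulnACA 2) mulnn mulnACA.
set X := m * l ^ 2 in h1 h2 h3 *.
have aux c d Y : Y <= d * X -> c * Y <= d * c * X.
  by move=> h; rewrite (mulnC d) -mulnA leq_mul2l h orbT.
have b1 := aux ci _ _ h1; have b2 := aux cr _ _ h2.
have b3 := aux cd _ _ h3; have b4 := aux ct _ _ h2.
by rewrite 3!mulnDl -2!addnA; do 3!(apply: leq_add => //).
Qed.

Lemma solve_spec (G : ttgraph) (tau : 'I_(ne G) -> nat) (l B : nat) r a :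
  series_parallel G -> 0 < l -> B = 5 + 3 * ne G ->
  r 1 = nv G -> r 2 = ne G -> r 3 = source G -> r 4 = sink G -> r 5 = l ->
  (forall k i, k < 16 -> a k i = 0) -> input_edges tau a ->
  awp B solve (solve_cost * (ne G * l ^ 2)) r a (fun r' a' => exists g T,
    [/\ tree_graph tau (ne G) g /\ extends tau (ne G) g,
        edge_set g = uedge (source G) (sink G), g (source G) (sink G) = Some T &
        written l tau T a']).
Proof.
move=> spG l0 eB r1 r2 r3 r4 r5 a0 inp.
have loopless := series_parallel_loopless spG.
have nm := series_parallel_nv spG.
have m0 : 0 < ne G by have := ltn_ord (source G); lia.
apply: (awp_weaken _ (solve_time_bound _ _ _ _ l0 m0 nm) (fun _ _ h => h)).
apply: awp_seq; apply: awp_weaken (@init_vertices_spec B G r a r1) (leqnn _) _.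
move=> ra aa [rows e6 e7 sa fa].
have gm0 : graph_mem l tau ra aa (fun _ _ => None).
  split; rewrite ?e6 ?sa //.
  - by move=> u; have [] := rows u.
  - by move=> u v; rewrite fa ?a0.
  - by move=> u; rewrite fa // a0 // /wsum big1.
  - by move=> u; rewrite fa // a0 // /wsum big1.
apply: awp_seq; apply: awp_weaken (@read_edges_spec B l G tau loopless ra aa _ _ _ gm0) (leqnn _) _.
- by rewrite eB.
- by rewrite sa.
- by move=> e; have [i1 i2 i3] := inp e; rewrite !fa.
move=> rb ab [[g [gm tg cg nb sg]] sb fb].
apply: awp_seq; apply: awp_weaken (@reduce_graph_spec B l G tau rb ab g gm tg (covers_extends cg) nb _ _ _ _ _) (leqnn _) _.
- split; first by move=> j; rewrite sb // e7 => jn; exists (Ordinal jn); rewrite fb //; have [] := rows (Ordinal jn).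
  move=> v u w _; exists v; first by rewrite sb // e7.
  by rewrite fb //; have [] := rows v.
- by rewrite sg edges_upto_full; exact: series_parallel_reducible.
- by rewrite sb ?sa.
- by rewrite sb ?sa.
- by rewrite sb.
move=> rc ac [g' [gm' tg' eg' sg' sc]].
have [T gT] : exists T, g' (source G) (sink G) = Some T.
  have : (source G, sink G) \in edge_set g' by rewrite sg' in_uedge !eqxx.
  by rewrite in_edge_set; case: (g' _ _) => // T; exists T.
have [_ RT] : 0 < ac 4 (cell (source G) (sink G)) /\
    tree_at l (@nat_of_ord (ne G)) tau (rc 6) ac (ac 4 (cell (source G) (sink G))) T.
  by have := gm_adj gm' (source G) (sink G); rewrite gT.
apply: awp_weaken (@trace_spec B l (ne G) tau _ rc ac T _ _ _) (leqnn _) _.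
- by rewrite eB; lia.
- exact: gm_l gm'.
- have -> : rc 3 = source G by rewrite sc // sb ?sa.
  have -> : rc 4 = sink G by rewrite sc // sb ?sa.
  by rewrite (gm_row gm').
- exact: tg_uniq tg' _ _ _ gT.
by move=> rd ad wr; exists g', T.
Qed.

(** For [l <= 0] the empty set is a solution, and only cell 0, which held the number of vertices,
    has to be cleared. Otherwise the base of the arrays is set to [5 + 3 * m], the first cell past
    the input. *)
Definition main_program : cmd :=
  Seq (Read 5 #4)
    (If (Le $5 #0) (Write #0 #0)
      (Seq (Read 1 #0) (Seq (Read 2 #1) (Seq (Read 3 #2) (Seq (Read 4 #3)
        (Seq (Assign 0 (#5 :+ ($2 :+ ($2 :+ $2)))) (compile solve))))))).

Definition nat_encode (G : ttgraph) (tau : 'I_(ne G) -> nat) (l : nat) : seq nat :=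
  [:: nv G; ne G; source G : nat; sink G : nat; l] ++
  flatten [seq [:: (ends e).1 : nat; (ends e).2 : nat; tau e] | e <- enum 'I_(ne G)].

Lemma encode_nat (G : ttgraph) (tau : 'I_(ne G) -> nat) (l : nat) :
  encode tau (Posz l) = map Posz (nat_encode tau l).
Proof. by rewrite /encode /nat_encode map_cat map_flatten -map_comp. Qed.

Lemma size_triples (T : Type) (f g h : T -> nat) (s : seq T) :
  size (flatten [seq [:: f x; g x; h x] | x <- s]) = 3 * size s.
Proof. by elim: s => //= x s ->; rewrite mulnS. Qed.

Lemma nth_triples (T : Type) (f g h : T -> nat) (s : seq T) x0 i :
  i < size s ->
  let t := flatten [seq [:: f x; g x; h x] | x <- s] in
  [/\ nth 0 t (3 * i) = f (nth x0 s i), nth 0 t (3 * i + 1) = g (nth x0 s i) &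
      nth 0 t (3 * i + 2) = h (nth x0 s i)].
Proof.
elim: s i => [|x s IH] [|i] // hi.
by have [h1 h2 h3] := IH i hi; rewrite mulnS !addSn !add0n; split.
Qed.

Lemma size_nat_encode (G : ttgraph) (tau : 'I_(ne G) -> nat) l :
  size (nat_encode tau l) = 5 + 3 * ne G.
Proof. by rewrite size_cat size_triples size_enum_ord. Qed.

Lemma nth_map_Posz (s : seq nat) i : nth 0%R (map Posz s) i = Posz (nth 0 s i).
Proof.
have [lt|ge] := ltnP i (size s); first by rewrite (nth_map 0).
by rewrite !nth_default ?size_map.
Qed.

Definition input_arrays (G : ttgraph) (tau : 'I_(ne G) -> nat) (l : nat) (k i : nat) : nat :=
  if k == 16 then nth 0 (nat_encode tau l) i else 0.

Lemma input_arrays_edges (G : ttgraph) (tau : 'I_(ne G) -> nat) l :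
  input_edges tau (input_arrays tau l).
Proof.
move=> e; have lt : e < size (enum 'I_(ne G)) by rewrite size_enum_ord.
have := nth_triples (fun e : 'I_(ne G) => (ends e).1 : nat) (fun e => (ends e).2 : nat) tau e lt.
rewrite nth_ord_enum => -[h1 h2 h3].
have tail i : input_arrays tau l 16 (5 + i) = nth 0 (flatten
    [seq [:: (ends e).1 : nat; (ends e).2 : nat; tau e] | e <- enum 'I_(ne G)]) i by [].
by split; rewrite -1?addnA tail.
Qed.

Lemma run_read x (a : nat) r M : run (Read x #a) r M 2 (update r x (M a)) M.
Proof. exact: RunRead. Qed.

(* For l <> 0 the bound is C * (m * l ^ 2), as m >= 1; for l = 0 it is C. *)
Theorem theorem6 :
  exists (P : cmd) (C : nat),
    forall (G : ttgraph) (tau : 'I_(ne G) -> nat) (l : int),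
      series_parallel G ->
      (forall e, 0 < tau e) ->
      exists (k : nat) (r : regs) (M : memory),
        [/\ run P init_regs (init_memory (encode tau l)) k r M,
            k <= C * maxn 1 (ne G * absz l ^ 2) &
            exists2 S : {set 'I_(ne G)},
              min_cost_solution tau l S & outputs M S].
Proof.
(* The 50 generously covers what surrounds [solve]: 9 time units in all if [l <= 0], and 22 before
   [solve] starts otherwise. *)
exists main_program, (50 + solve_cost) => G tau l spG _.
set M0 := init_memory (encode tau l); set K := maxn 1 _.
have K1 : 0 < K by rewrite leq_max.
have [l0|l0] := boolP (l <= 0)%R.
  exists (2 + (3 + 3).+1), (update init_regs 5 l), (update M0 0 0%R); split.
  - apply: RunSeq (run_read _ _ _ _) _.
    by apply: (@RunIfTrue (Le $5 #0)) => //; exact: RunWrite.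
  - by rewrite mulnDl; apply: leq_trans (leq_addr _ _); exact: (@leq_trans (50 * 1)) (leq_mul _ K1).
  exists set0; last by exists [::]; [rewrite enum_set0 | split].
  split; last by move=> S' _; rewrite cards0.
  by move=> p _; apply: Order.POrderTheory.le_trans l0 _.
case: l l0 @M0 @K K1 => [l|//] l0 M0 K K1.
have {}l0 : 0 < l by case: (l) l0.
pose B := 5 + 3 * ne G.
pose r0 := upd (upd (upd (upd (upd (upd (fun=> 0)
  5 l) 1 (nv G)) 2 (ne G)) 3 (source G)) 4 (sink G)) 0 B.
pose R0 := update (update (update (update (update (update init_regs
  5 (Posz l)) 1 (Posz (nv G))) 2 (Posz (ne G))) 3 (Posz (source G))) 4 (Posz (sink G)))
  0 (Posz B).
have rep0 : rep B r0 (input_arrays tau l) R0 M0.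
  split=> //.
  - by move=> x; rewrite /R0 /r0 /update !updE; do !case: ifP.
  (* Cells past the input hold the default value 0, so arrays 0 to 15 start out as zero. *)
  - move=> k i k16; rewrite /M0 /init_memory encode_nat nth_map_Posz nth_default.
      by rewrite /input_arrays ltn_eqF.
    by rewrite size_nat_encode -/B -addnA leq_addr.
  - by move=> i iB; rewrite /M0 /init_memory encode_nat nth_map_Posz.
have [|k [R' [M' [r' [a' [hrun hk hrep [g [T [[tg eg] sg gT wr]]]]]]]]] :=
  @solve_spec G tau l B r0 (input_arrays tau l) spG l0 erefl erefl erefl erefl erefl erefl _
    (@input_arrays_edges G tau l) R0 M0 rep0.
  by move=> k i k16; rewrite /input_arrays ltn_eqF.
case: wr => O [uO szO cO a0 aS].
exists (2 + (3 + (2 + (2 + (2 + (2 + (8 + k)))))).+1), R', M'; split.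
- apply: RunSeq (run_read _ _ _ _) _; apply: (@RunIfFalse (Le $5 #0)).
    by rewrite /= -[M0 4]/(Posz l) lez_nat -ltnNge.
  do 4!apply: RunSeq (run_read _ _ _ _) _.
  apply: RunSeq (RunAssign _ _ _ _) _.
  rewrite (_ : eval _ _ = Posz B) // /update /= -[M0 1]/(Posz (ne G)) /B; lia.
- have hK : ne G * l ^ 2 <= K by rewrite leq_max leqnn orbT.
  have : k <= solve_cost * K by apply: leq_trans hk _; rewrite leq_mul2l hK orbT.
  have : 50 <= 50 * K by rewrite leq_pmulr.
  by rewrite mulnDl; lia.
have hB i : i <= size O -> M' i = Posz (a' 16 i).
  move=> hi; case: hrep => _ _ _; apply.
  by apply: leq_ltn_trans hi _; have := size_uniq_ord uO; rewrite /B; lia.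
exists [set e in O].
  apply: feasible_minimum tg eg sg gT cO _.
  by rewrite -szO cardsE; exact/card_uniqP.
exists O; first by apply: uniq_perm => //; [exact: enum_uniq | move=> e; rewrite mem_enum inE].
split; first by rewrite hB // a0.
have -> : [seq Posz (nat_of_ord e) | e <- O] = map Posz [seq nat_of_ord e | e <- O].
  by rewrite -map_comp.
rewrite -aS -map_comp; apply/eq_in_map => i; rewrite mem_iota /= => hi.
by rewrite hB.
Qed.
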